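(* Let $F:\mathcal{D}\to\mathcal{E}$ be an additive functor of exact categories, where both $\mathcal{D}$ and $\mathcal{E}$ are weakly $(\omega,\mathbf{AdEpi})$-coelementary and $\mathcal{D}$ has an admissible homologically left complete right truncation system. Suppose that $F$ commutes with countable products. Let $\mathcal{B}$ be a subcategory of $Ch_-(\mathcal{D})$ which is a homological right deformation of $F$. Then $F:Ch(\mathcal{D})\to Ch(\mathcal{E})$ is right deformable.
   Context: Exact categories are Quillen exact categories, assumed weakly idempotent complete; $\mathbf{AdEpi}$ denotes admissible epimorphisms. $Ch(\mathcal{D})$ (resp. $Ch_-(\mathcal{D})$) is the category of unbounded (resp. bounded above) complexes, homologically graded. A quasi-isomorphism (weak equivalence) is a chain map with acyclic cone. $F$ also denotes the induced functor on complexes. $\mathcal{E}$ is weakly $(\omega,\mathbf{AdEpi})$-coelementary if limits of functors $\omega^{op}\to\mathcal{E}$ with all transition maps admissible epimorphisms exist, and the limit functor on the category of such functors sends object-wise short exact sequences to short exact sequences. $F:Ch(\mathcal{D})\to Ch(\mathcal{E})$ is right deformable if there is a functor $Q:Ch(\mathcal{D})\to Ch(\mathcal{D})$ and a natural weak equivalence $\eta:\mathrm{Id}\to Q$ such that $F$ preserves weak equivalences between objects in the essential image of $Q$. A full subcategory $i_{\mathcal{B}}:\mathcal{B}\to Ch_-(\mathcal{D})$ is a homological right deformation of $Ch_-(\mathcal{D})$ if it is degree-wise split extension closed (if $0\to X\to Y\to Z\to0$ is split exact in each degree with $X,Z\in\mathcal{B}$, then $Y\in\mathcal{B}$) and there are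 a functor $Q_-:Ch_-(\mathcal{D})\to\mathcal{B}$ and a natural quasi-isomorphism $\eta:\mathrm{Id}\to i_{\mathcal{B}}\circ Q_-$ which is an admissible monomorphism in each degree, such that $Q_-(X)$ is concentrated in degrees $\le n$ whenever $X$ is. It is a homological right deformation of $F$ if moreover $F$ preserves weak equivalences between complexes in $\mathcal{B}$. A right truncation system on $\mathcal{D}$ is a sequence of functors $\cdots\to T_1\to T_0$, $T_n:Ch(\mathcal{D})\to Ch(\mathcal{D})$, with natural transformations $\psi_n:\mathrm{Id}\to T_n$ compatible with $T_{n+1}\to T_n$, such that: for all $X$ and $n\in\mathbb{N}$, $T_n(X)$ is concentrated in degrees $\le n$; the map $T_n\to T_nT_{n+1}$ is a natural quasi-isomorphism; $X\to T_n(X)$ is an admissible monomorphism in degrees $<n$; if $X$ is concentrated in degrees $\le n$, then $X\to T_n(X)$ is a quasi-isomorphism; $T_n$ preserves weak equivalences. It is admissible if the maps $T_{n+1}(X)\to T_n(X)$ are admissible epimorphisms in degrees $<n$, and homologically left complete if $\lim_{\omega^{op}}\psi_n$ exists and is a natural weak equivalence. *)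

(* Defs.v *)
From HB Require Import structures.
From mathcomp Require Import all_boot all_order all_algebra.
From mathcomp Require Import boolp.

Set Implicit Arguments.
Unset Strict Implicit.
Unset Printing Implicit Defensive.

Import GRing.Theory.
Local Open Scope ring_scope.

Record category := Category {
  Ob :> Type;
  Hom : Ob -> Ob -> Type;
  idm : forall X, Hom X X;
  comp : forall X Y Z, Hom Y Z -> Hom X Y -> Hom X Z;
  compA : forall X Y Z W (h : Hom Z W) (g : Hom Y Z) (f : Hom X Y),
    comp h (comp g f) = comp (comp h g) f;
  comp1m : forall X Y (f : Hom X Y), comp (idm Y) f = f;
  compm1 : forall X Y (f : Hom X Y), comp f (idm X) = f }.

Arguments Hom {c} X Y.
Arguments idm {c} X.
Arguments comp {c X Y Z} g f : rename.

Declare Scope cat_scope.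
Delimit Scope cat_scope with cat.
Notation "g ∘ f" := (comp g f) (at level 40, left associativity) : cat_scope.
Local Open Scope cat_scope.

Definition is_iso (C : category) (X Y : C) (f : Hom X Y) : Prop :=
  exists g : Hom Y X, g ∘ f = idm X /\ f ∘ g = idm Y.

Record functor (C D : category) := Functor {
  fobj :> C -> D;
  fmap : forall X Y : C, Hom X Y -> Hom (fobj X) (fobj Y);
  fmap_id : forall X : C, fmap (idm X) = idm (fobj X);
  fmap_comp : forall (X Y Z : C) (g : Hom Y Z) (f : Hom X Y),
    fmap (g ∘ f) = fmap g ∘ fmap f }.

Arguments fmap {C D} F {X Y} f : rename.

Definition id_functor (C : category) : functor C C :=
  @Functor C C (fun X => X) (fun X Y f => f) (fun X => erefl)
    (fun X Y Z g f => erefl).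

Lemma comp_functor_id (C D E : category) (G : functor D E) (F : functor C D)
  (X : C) : fmap G (fmap F (idm X)) = idm (G (F X)).
Proof. by rewrite !fmap_id. Qed.

Lemma comp_functor_comp (C D E : category) (G : functor D E) (F : functor C D)
  (X Y Z : C) (g : Hom Y Z) (f : Hom X Y) :
  fmap G (fmap F (g ∘ f)) = fmap G (fmap F g) ∘ fmap G (fmap F f).
Proof. by rewrite !fmap_comp. Qed.

Definition comp_functor (C D E : category) (G : functor D E)
    (F : functor C D) : functor C E :=
  @Functor C E (fun X => G (F X)) (fun X Y f => fmap G (fmap F f))
    (comp_functor_id G F) (@comp_functor_comp _ _ _ G F).

Record nat_trans (C D : category) (F G : functor C D) := NatTrans {
  ntc :> forall X : C, Hom (F X) (G X);
  ntc_nat : forall (X Y : C) (f : Hom X Y),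
    fmap G f ∘ ntc X = ntc Y ∘ fmap F f }.

Definition full_sub (C : category) (P : C -> Prop) : category :=
  @Category {X : C | P X} (fun X Y => Hom (sval X) (sval Y))
    (fun X => idm (sval X)) (fun X Y Z g f => g ∘ f)
    (fun X Y Z W => @compA C (sval X) (sval Y) (sval Z) (sval W))
    (fun X Y => @comp1m C (sval X) (sval Y))
    (fun X Y => @compm1 C (sval X) (sval Y)).

Definition full_sub_incl (C : category) (P : C -> Prop) :
    functor (full_sub P) C :=
  @Functor (full_sub P) C (fun X => sval X) (fun X Y f => f)
    (fun X => erefl) (fun X Y Z g f => erefl).

Definition ess_image (C D : category) (Q : functor C D) (Y : D) : Prop :=
  exists (X : C) (f : Hom (Q X) Y), is_iso f.

Definition is_product (C : category) (I : Type) (X : I -> C) (P : C)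
    (p : forall i, Hom P (X i)) : Prop :=
  forall (W : C) (w : forall i, Hom W (X i)),
    exists! u : Hom W P, forall i, p i ∘ u = w i.

(* A functor omega^op -> C is given by its objects and its consecutive
   transition maps; every other transition map is a composite of these. *)
Record tower (C : category) := Tower {
  tob :> nat -> C;
  tmap : forall n, Hom (tob n.+1) (tob n) }.

Arguments tmap {C} X n : rename.

Record tower_map (C : category) (X Y : tower C) := TowerMap {
  tmc :> forall n, Hom (X n) (Y n);
  tmc_nat : forall n, tmap Y n ∘ tmc n.+1 = tmc n ∘ tmap X n }.

Definition is_tower_cone (C : category) (X : tower C) (L : C)
    (p : forall n, Hom L (X n)) : Prop :=
  forall n, tmap X n ∘ p n.+1 = p n.

Definition is_tower_limit (C : category) (X : tower C) (L : C)
    (p : forall n, Hom L (X n)) : Prop :=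
  is_tower_cone p /\
  forall (W : C) (w : forall n, Hom W (X n)), is_tower_cone w ->
    exists! u : Hom W L, forall n, p n ∘ u = w n.

(* The choice structure that [zmodType] puts on hom-groups is no restriction,
   classically; nor is the choice of a zero object and of biproducts. *)
Record add_category := AddCategory {
  aob : Type;
  ahom : aob -> aob -> zmodType;
  aid : forall X, ahom X X;
  acomp : forall X Y Z, ahom Y Z -> ahom X Y -> ahom X Z;
  acompA : forall X Y Z W (h : ahom Z W) (g : ahom Y Z) (f : ahom X Y),
    acomp h (acomp g f) = acomp (acomp h g) f;
  acomp1m : forall X Y (f : ahom X Y), acomp (aid Y) f = f;
  acompm1 : forall X Y (f : ahom X Y), acomp f (aid X) = f;
  acompDl : forall X Y Z (g h : ahom Y Z) (f : ahom X Y),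
    acomp (g + h) f = acomp g f + acomp h f;
  acompDr : forall X Y Z (g : ahom Y Z) (f h : ahom X Y),
    acomp g (f + h) = acomp g f + acomp g h;
  azero : aob;
  azeroP : aid azero = 0;
  abiprod : aob -> aob -> aob;
  abin1 : forall X Y, ahom X (abiprod X Y);
  abin2 : forall X Y, ahom Y (abiprod X Y);
  abpr1 : forall X Y, ahom (abiprod X Y) X;
  abpr2 : forall X Y, ahom (abiprod X Y) Y;
  abpr1in1 : forall X Y, acomp (abpr1 X Y) (abin1 X Y) = aid X;
  abpr2in2 : forall X Y, acomp (abpr2 X Y) (abin2 X Y) = aid Y;
  abpr1in2 : forall X Y, acomp (abpr1 X Y) (abin2 X Y) = 0;
  abpr2in1 : forall X Y, acomp (abpr2 X Y) (abin1 X Y) = 0;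
  absum : forall X Y,
    acomp (abin1 X Y) (abpr1 X Y) + acomp (abin2 X Y) (abpr2 X Y) =
    aid (abiprod X Y) }.

Definition add_cat (A : add_category) : category :=
  @Category (aob A) (fun X Y => ahom X Y) (@aid A) (@acomp A) (@acompA A)
    (@acomp1m A) (@acompm1 A).
Coercion add_cat : add_category >-> category.

HB.instance Definition _ (A : add_category) (X Y : A) :=
  GRing.Zmodule.copy (@Hom (add_cat A) X Y) (@ahom A X Y).

Section AddTheory.
Variable A : add_category.

Lemma compDl (X Y Z : A) (g h : Hom Y Z) (f : Hom X Y) :
  (g + h) ∘ f = g ∘ f + h ∘ f.
Proof. exact: acompDl. Qed.

Lemma compDr (X Y Z : A) (g : Hom Y Z) (f h : Hom X Y) :
  g ∘ (f + h) = g ∘ f + g ∘ h.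
Proof. exact: acompDr. Qed.

Lemma comp0m (X Y Z : A) (f : Hom X Y) : (0 : Hom Y Z) ∘ f = 0.
Proof.
by apply: (@addrI (Hom X Z) ((0 : Hom Y Z) ∘ f)); rewrite -compDl !addr0.
Qed.

Lemma compm0 (X Y Z : A) (g : Hom Y Z) : g ∘ (0 : Hom X Y) = 0.
Proof.
by apply: (@addrI (Hom X Z) (g ∘ (0 : Hom X Y))); rewrite -compDr !addr0.
Qed.

Lemma compNm (X Y Z : A) (g : Hom Y Z) (f : Hom X Y) :
  (- g) ∘ f = - (g ∘ f).
Proof.
apply: (@addrI (Hom X Z) (g ∘ f)).
by rewrite -compDl !subrr comp0m.
Qed.

Lemma compmN (X Y Z : A) (g : Hom Y Z) (f : Hom X Y) :
  g ∘ (- f) = - (g ∘ f).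
Proof.
apply: (@addrI (Hom X Z) (g ∘ f)).
by rewrite -compDr !subrr compm0.
Qed.

Definition biprod (X Y : A) : A := abiprod X Y.
Definition bin1 (X Y : A) : Hom X (biprod X Y) := abin1 X Y.
Definition bin2 (X Y : A) : Hom Y (biprod X Y) := abin2 X Y.
Definition bpr1 (X Y : A) : Hom (biprod X Y) X := abpr1 X Y.
Definition bpr2 (X Y : A) : Hom (biprod X Y) Y := abpr2 X Y.

Lemma bpr1in1 (X Y : A) : bpr1 X Y ∘ bin1 X Y = idm X.
Proof. exact: abpr1in1. Qed.

Lemma bpr2in2 (X Y : A) : bpr2 X Y ∘ bin2 X Y = idm Y.
Proof. exact: abpr2in2. Qed.

Lemma bpr1in2 (X Y : A) : bpr1 X Y ∘ bin2 X Y = 0.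
Proof. exact: abpr1in2. Qed.

Lemma bpr2in1 (X Y : A) : bpr2 X Y ∘ bin1 X Y = 0.
Proof. exact: abpr2in1. Qed.

Lemma bsum (X Y : A) :
  bin1 X Y ∘ bpr1 X Y + bin2 X Y ∘ bpr2 X Y = idm (biprod X Y).
Proof. exact: absum. Qed.

(* The lower triangular matrix ((a, 0), (b, c)). *)
Definition tri (X X' Y Y' : A) (a : Hom X X') (b : Hom X Y') (c : Hom Y Y') :
    Hom (biprod X Y) (biprod X' Y') :=
  bin1 X' Y' ∘ a ∘ bpr1 X Y + bin2 X' Y' ∘ (b ∘ bpr1 X Y + c ∘ bpr2 X Y).

Lemma tri_pr1 (X X' Y Y' : A) (a : Hom X X') (b : Hom X Y') (c : Hom Y Y') :
  bpr1 X' Y' ∘ tri a b c = a ∘ bpr1 X Y.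
Proof.
by rewrite /tri compDr !compA bpr1in1 bpr1in2 comp1m comp0m addr0.
Qed.

Lemma tri_pr2 (X X' Y Y' : A) (a : Hom X X') (b : Hom X Y') (c : Hom Y Y') :
  bpr2 X' Y' ∘ tri a b c = b ∘ bpr1 X Y + c ∘ bpr2 X Y.
Proof.
by rewrite /tri compDr !compA bpr2in1 bpr2in2 comp1m !comp0m add0r.
Qed.

Lemma tri_comp (X X' X'' Y Y' Y'' : A)
    (a : Hom X X') (b : Hom X Y') (c : Hom Y Y')
    (a' : Hom X' X'') (b' : Hom X' Y'') (c' : Hom Y' Y'') :
  tri a' b' c' ∘ tri a b c = tri (a' ∘ a) (b' ∘ a + c' ∘ b) (c' ∘ c).
Proof.
rewrite {1}/tri compDl -compA tri_pr1 -(compA (bin2 X'' Y'')) compDl.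
rewrite -(compA b') -(compA c') tri_pr1 tri_pr2 /tri.
by rewrite !(compDl, compDr, compA) !addrA.
Qed.

Lemma tri0 (X X' Y Y' : A) : tri (0 : Hom X X') 0 (0 : Hom Y Y') = 0.
Proof. by rewrite /tri compm0 !comp0m addr0 compm0 addr0. Qed.

Definition is_zero (X : A) : Prop := idm X = 0.

Definition is_kernel (X Y Z : A) (i : Hom X Y) (p : Hom Y Z) : Prop :=
  p ∘ i = 0 /\
  forall (W : A) (h : Hom W Y), p ∘ h = 0 ->
    exists! k : Hom W X, i ∘ k = h.

Definition is_cokernel (X Y Z : A) (i : Hom X Y) (p : Hom Y Z) : Prop :=
  p ∘ i = 0 /\
  forall (W : A) (h : Hom Y W), h ∘ i = 0 :> Hom X W ->
    exists! k : Hom Z W, k ∘ p = h.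

Definition is_pushout (X Y X' Y' : A) (i : Hom X Y) (f : Hom X X')
    (i' : Hom X' Y') (f' : Hom Y Y') : Prop :=
  f' ∘ i = i' ∘ f /\
  forall (W : A) (a : Hom Y W) (b : Hom X' W), a ∘ i = b ∘ f ->
    exists! k : Hom Y' W, k ∘ f' = a /\ k ∘ i' = b.

Definition is_pullback (Y Z Y' Z' : A) (p : Hom Y Z) (f : Hom Z' Z)
    (p' : Hom Y' Z') (f' : Hom Y' Y) : Prop :=
  p ∘ f' = f ∘ p' /\
  forall (W : A) (a : Hom W Y) (b : Hom W Z'), p ∘ a = f ∘ b ->
    exists! k : Hom W Y', f' ∘ k = a /\ p' ∘ k = b.

Definition split_exact (X Y Z : A) (f : Hom X Y) (g : Hom Y Z) : Prop :=
  exists (r : Hom Y X) (s : Hom Z Y),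
    [/\ r ∘ f = idm X, g ∘ s = idm Z, g ∘ f = 0, r ∘ s = 0
      & f ∘ r + s ∘ g = idm Y].

Definition weakly_idempotent_complete : Prop :=
  forall (X Y : A) (r : Hom X Y) (s : Hom Y X), r ∘ s = idm Y ->
    exists (K : A) (k : Hom K X), is_kernel k r.

End AddTheory.

Record add_functor (A B : add_category) := AddFunctor {
  add_fun :> functor A B;
  add_funD : forall (X Y : A) (f g : Hom X Y),
    fmap add_fun (f + g : Hom X Y) =
      (fmap add_fun f : Hom (add_fun X) (add_fun Y)) + fmap add_fun g }.

Lemma add_fun0 (A B : add_category) (F : add_functor A B) (X Y : A) :
  fmap F (0 : Hom X Y) = 0 :> Hom (F X) (F Y).
Proof.
apply: (@addrI (Hom (F X) (F Y)) (fmap F (0 : Hom X Y))).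
by rewrite -add_funD !addr0.
Qed.

Definition preserves_countable_products (C D : category) (F : functor C D) :
    Prop :=
  forall (I : countType) (X : I -> C) (P : C) (p : forall i, Hom P (X i)),
    is_product p -> is_product (fun i => fmap F (p i)).

Section ConflationClass.
Variables (A : add_category)
  (conf : forall X Y Z : A, Hom X Y -> Hom Y Z -> Prop).

Definition adm_mono_for (X Y : A) (i : Hom X Y) : Prop :=
  exists (Z : A) (p : Hom Y Z), conf i p.

Definition adm_epi_for (Y Z : A) (p : Hom Y Z) : Prop :=
  exists (X : A) (i : Hom X Y), conf i p.

Record exact_structure : Prop := ExactStructure {
  conf_kernel : forall (X Y Z : A) (i : Hom X Y) (p : Hom Y Z),
    conf i p -> is_kernel i p;
  conf_cokernel : forall (X Y Z : A) (i : Hom X Y) (p : Hom Y Z),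
    conf i p -> is_cokernel i p;
  conf_iso : forall (X Y Z X' Y' Z' : A) (i : Hom X Y) (p : Hom Y Z)
      (i' : Hom X' Y') (p' : Hom Y' Z')
      (a : Hom X X') (b : Hom Y Y') (c : Hom Z Z'),
    is_iso a -> is_iso b -> is_iso c ->
    b ∘ i = i' ∘ a -> c ∘ p = p' ∘ b -> conf i p -> conf i' p';
  adm_mono_id : forall X : A, adm_mono_for (idm X);
  adm_epi_id : forall X : A, adm_epi_for (idm X);
  adm_mono_comp : forall (X Y Z : A) (i : Hom X Y) (j : Hom Y Z),
    adm_mono_for i -> adm_mono_for j -> adm_mono_for (j ∘ i);
  adm_epi_comp : forall (X Y Z : A) (p : Hom X Y) (q : Hom Y Z),
    adm_epi_for p -> adm_epi_for q -> adm_epi_for (q ∘ p);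
  adm_mono_pushout : forall (X Y X' : A) (i : Hom X Y) (f : Hom X X'),
    adm_mono_for i ->
    exists (Y' : A) (i' : Hom X' Y') (f' : Hom Y Y'),
      is_pushout i f i' f' /\ adm_mono_for i';
  adm_epi_pullback : forall (Y Z Z' : A) (p : Hom Y Z) (f : Hom Z' Z),
    adm_epi_for p ->
    exists (Y' : A) (p' : Hom Y' Z') (f' : Hom Y' Y),
      is_pullback p f p' f' /\ adm_epi_for p' }.

End ConflationClass.

Record exact_category := ExactCategory {
  exact_add :> add_category;
  ses : forall X Y Z : exact_add, Hom X Y -> Hom Y Z -> Prop;
  sesP : exact_structure ses }.

Arguments ses {e X Y Z} i p : rename.

Definition adm_mono (E : exact_category) (X Y : E) (i : Hom X Y) : Prop :=
  adm_mono_for (@ses E) i.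

Definition adm_epi (E : exact_category) (Y Z : E) (p : Hom Y Z) : Prop :=
  adm_epi_for (@ses E) p.

Definition adm_epi_tower (E : exact_category) (X : tower E) : Prop :=
  forall n, adm_epi (tmap X n).

(* The limit functor is described on arbitrary limit cones, [f] and [g] being
   the maps that [alpha] and [beta] induce on the limits. *)
Definition weakly_omega_coelementary (E : exact_category) : Prop :=
  (forall X : tower E, adm_epi_tower X ->
     exists (L : E) (p : forall n, Hom L (X n)), is_tower_limit p) /\
  (forall (X Y Z : tower E) (alpha : tower_map X Y) (beta : tower_map Y Z),
     adm_epi_tower X -> adm_epi_tower Y -> adm_epi_tower Z ->
     (forall n, ses (alpha n) (beta n)) ->
     forall (LX LY LZ : E) (pX : forall n, Hom LX (X n))
       (pY : forall n, Hom LY (Y n)) (pZ : forall n, Hom LZ (Z n)),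
     is_tower_limit pX -> is_tower_limit pY -> is_tower_limit pZ ->
     forall (f : Hom LX LY) (g : Hom LY LZ),
     (forall n, pY n ∘ f = alpha n ∘ pX n) ->
     (forall n, pZ n ∘ g = beta n ∘ pY n) ->
     ses f g).

Section Complexes.
Variable A : add_category.

Record complex := Complex {
  cob :> int -> A;
  cd : forall n : int, Hom (cob n) (cob (n - 1));
  cdd : forall n : int,
    cd (n - 1) ∘ cd n = 0 :> Hom (cob n) (cob (n - 1 - 1)) }.

Record chain_map (X Y : complex) := ChainMap {
  cm :> forall n : int, Hom (X n) (Y n);
  cmd : forall n : int, cd Y n ∘ cm n = cm (n - 1) ∘ cd X n }.

Lemma chain_map_eq (X Y : complex) (f g : chain_map X Y) :
  (forall n, f n = g n) -> f = g.
Proof.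
case: f g => [f fd] [g gd] /= fg.
have efg : f = g by apply: functional_extensionality_dep.
by case: _ / efg in gd *; congr ChainMap; apply: Prop_irrelevance.
Qed.

Lemma ch_id_cmd (X : complex) (n : int) :
  cd X n ∘ idm (X n) = idm (X (n - 1)) ∘ cd X n.
Proof. by rewrite comp1m compm1. Qed.

Definition ch_id (X : complex) : chain_map X X := ChainMap (ch_id_cmd X).

Lemma ch_comp_cmd (X Y Z : complex) (g : chain_map Y Z) (f : chain_map X Y)
  (n : int) : cd Z n ∘ (g n ∘ f n) = (g (n - 1) ∘ f (n - 1)) ∘ cd X n.
Proof. by rewrite compA cmd -compA cmd compA. Qed.

Definition ch_comp (X Y Z : complex) (g : chain_map Y Z) (f : chain_map X Y) :
  chain_map X Z := ChainMap (ch_comp_cmd g f).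

Lemma ch_compA (X Y Z W : complex) (h : chain_map Z W) (g : chain_map Y Z)
  (f : chain_map X Y) : ch_comp h (ch_comp g f) = ch_comp (ch_comp h g) f.
Proof. by apply: chain_map_eq => n; apply: compA. Qed.

Lemma ch_comp1m (X Y : complex) (f : chain_map X Y) : ch_comp (ch_id Y) f = f.
Proof. by apply: chain_map_eq => n; apply: comp1m. Qed.

Lemma ch_compm1 (X Y : complex) (f : chain_map X Y) : ch_comp f (ch_id X) = f.
Proof. by apply: chain_map_eq => n; apply: compm1. Qed.

Definition Ch : category := Category ch_compA ch_comp1m ch_compm1.

Definition concentrated_le (n : int) (X : complex) : Prop :=
  forall k : int, n < k -> is_zero (X k).

Definition bounded_above (X : complex) : Prop :=
  exists n : int, concentrated_le n X.

Definition Ch_minus : category := @full_sub Ch bounded_above.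

(* Degree n of the cone is X_(n-1) (+) Y_n, with d(x, y) = (- dx, fx + dy). *)
Section Cone.
Variables (X Y : complex) (f : chain_map X Y).

Definition cone_ob (n : int) : A := biprod (X (n - 1)) (Y n).

Definition cone_d (n : int) : Hom (cone_ob n) (cone_ob (n - 1)) :=
  tri (- cd X (n - 1)) (f (n - 1)) (cd Y n).

Lemma cone_dd (n : int) : cone_d (n - 1) ∘ cone_d n = 0.
Proof.
by rewrite tri_comp compNm !compmN !cdd cmd addNr opprK tri0.
Qed.

Definition cone : complex := Complex cone_dd.

End Cone.

End Complexes.

Section InducedFunctor.
Variables (A B : add_category) (F : add_functor A B).

Lemma Ch_ob_cdd (X : complex A) (n : int) :
  fmap F (cd X (n - 1)) ∘ fmap F (cd X n) = 0.
Proof. by rewrite -fmap_comp cdd add_fun0. Qed.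

Definition Ch_ob (X : complex A) : complex B := Complex (Ch_ob_cdd X).

Lemma Ch_hom_cmd (X Y : complex A) (f : chain_map X Y) (n : int) :
  cd (Ch_ob Y) n ∘ fmap F (f n) = fmap F (f (n - 1)) ∘ cd (Ch_ob X) n.
Proof. by rewrite -!fmap_comp cmd. Qed.

Definition Ch_hom (X Y : complex A) (f : chain_map X Y) :
  chain_map (Ch_ob X) (Ch_ob Y) :=
  @ChainMap B (Ch_ob X) (Ch_ob Y) (fun n => fmap F (f n)) (Ch_hom_cmd f).

Lemma Ch_hom_id (X : complex A) : Ch_hom (ch_id X) = ch_id (Ch_ob X).
Proof. by apply: chain_map_eq => n; apply: fmap_id. Qed.

Lemma Ch_hom_comp (X Y Z : complex A) (g : chain_map Y Z) (f : chain_map X Y) :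
  Ch_hom (ch_comp g f) = ch_comp (Ch_hom g) (Ch_hom f).
Proof. by apply: chain_map_eq => n; apply: fmap_comp. Qed.

Definition Ch_functor : functor (Ch A) (Ch B) :=
  @Functor (Ch A) (Ch B) Ch_ob Ch_hom Ch_hom_id Ch_hom_comp.

End InducedFunctor.

Definition acyclic (E : exact_category) (X : complex E) : Prop :=
  exists (Z : int -> E) (i : forall n, Hom (Z n) (X n))
    (p : forall n, Hom (X n) (Z (n - 1))),
    forall n, ses (i n) (p n) /\ cd X n = i (n - 1) ∘ p n.

Definition weak_equiv (E : exact_category) (X Y : complex E)
    (f : chain_map X Y) : Prop := acyclic (cone f).

Definition preserves_weak_equiv_on (D E : exact_category)
    (P : complex D -> Prop) (F : functor (Ch D) (Ch E)) : Prop :=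
  forall (X Y : complex D) (f : chain_map X Y), P X -> P Y ->
    weak_equiv f -> @weak_equiv E (F X) (F Y) (@fmap (Ch D) (Ch E) F X Y f).

Definition right_deformable (D E : exact_category)
    (F : functor (Ch D) (Ch E)) : Prop :=
  exists (Q : functor (Ch D) (Ch D)) (eta : nat_trans (id_functor (Ch D)) Q),
    (forall X : Ch D, weak_equiv (eta X)) /\
    preserves_weak_equiv_on (ess_image Q) F.

Section HomologicalRightDeformation.
Variables (D : exact_category) (B : Ch_minus D -> Prop).

(* [B] is the class of objects of a full subcategory of [Ch_minus D]. *)
Definition degreewise_split_ext_closed : Prop :=
  forall (X Y Z : Ch_minus D)
    (f : chain_map (sval X) (sval Y)) (g : chain_map (sval Y) (sval Z)),
    (forall n, split_exact (f n) (g n)) -> B X -> B Z -> B Y.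

Definition homological_right_deformation : Prop :=
  degreewise_split_ext_closed /\
  exists (Qm : functor (Ch_minus D) (full_sub B))
    (eta : nat_trans (id_functor (Ch_minus D))
             (comp_functor (full_sub_incl B) Qm)),
    [/\ forall X : Ch_minus D, weak_equiv (eta X),
        forall (X : Ch_minus D) (n : int), adm_mono (cm (eta X) n)
      & forall (X : Ch_minus D) (n : int), concentrated_le n (sval X) ->
          concentrated_le n (sval (sval (Qm X)))].

Definition homological_right_deformation_of (E : exact_category)
    (F : add_functor D E) : Prop :=
  homological_right_deformation /\
  preserves_weak_equiv_on
    (fun X => exists Xb : bounded_above X, B (exist _ X Xb)) (Ch_functor F).

End HomologicalRightDeformation.

Section RightTruncation.
Variable D : exact_category.

Record right_truncation_system := RightTruncationSystem {
  trunc :> nat -> functor (Ch D) (Ch D);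
  trunc_map : forall n, nat_trans (trunc n.+1) (trunc n);
  trunc_unit : forall n, nat_trans (id_functor (Ch D)) (trunc n);
  trunc_unit_compat : forall (n : nat) (X : Ch D),
    trunc_map n X ∘ trunc_unit n.+1 X = trunc_unit n X;
  trunc_conc : forall (X : Ch D) (n : nat), concentrated_le n (trunc n X);
  trunc_trunc : forall (X : Ch D) (n : nat),
    weak_equiv (fmap (trunc n) (trunc_unit n.+1 X));
  trunc_unit_mono : forall (X : Ch D) (n : nat) (k : int), k < n ->
    adm_mono (cm (trunc_unit n X) k);
  trunc_unit_weak_equiv : forall (X : Ch D) (n : nat), concentrated_le n X ->
    weak_equiv (trunc_unit n X);
  trunc_preserves : forall n : nat,
    preserves_weak_equiv_on (fun=> True) (trunc n) }.

Variable T : right_truncation_system.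

Definition admissible_truncation : Prop :=
  forall (X : Ch D) (n : nat) (k : int), k < n ->
    adm_epi (cm (trunc_map T n X) k).

Definition trunc_tower (X : Ch D) : tower (Ch D) :=
  Tower (fun n => trunc_map T n X).

(* The limit of the [T n] is formed object-wise; [psi] is the map induced on
   it by the compatible family of the [trunc_unit]. *)
Definition homologically_left_complete : Prop :=
  exists (L : functor (Ch D) (Ch D)) (pi : forall n, nat_trans L (T n))
    (psi : nat_trans (id_functor (Ch D)) L),
    [/\ forall X : Ch D,
          @is_tower_limit _ (trunc_tower X) (L X) (fun n => pi n X),
        forall (X : Ch D) (n : nat), pi n X ∘ psi X = trunc_unit T n X
      & forall X : Ch D, weak_equiv (psi X)].

End RightTruncation.

(* Main.v *)
From HB Require Import structures.
From mathcomp Require Import all_boot all_order all_algebra.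
From mathcomp Require Import boolp.
Require Import Defs.

(* The homotopy limit of a tower [Y] of complexes is modelled, up to suspension, by
   the cone of [1 - t] on the countable product of the [Y n]; it preserves weak
   equivalences because countable products exist and are exact, and a tower whose
   transition maps are eventually admissible epimorphisms in each degree has its
   limit as homotopy limit.  Hence [X] is the homotopy limit of the [T_n X], and so
   of [G_n X = Q_- (T_n X)].  Replacing this tower by one with degreewise split
   transition maps, [Q X] is the limit of the resulting [R_n X], a limit which [F]
   preserves, being determined by products and split exact sequences.  For
   [L = Q X], comparing the towers [F G_n L -> F G_n R_(n+1) -> F G_n R_n <- F R_n]
   shows that [F L] is the homotopy limit of [F G_n L], and a weak equivalence
   [L -> L'] induces weak equivalences between the bounded above complexes [G_n L]
   and [G_n L'] of [B], on which [F] preserves them.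
   As the categories are only weakly idempotent complete, weak equivalences satisfy
   2-out-of-3, but in general neither 2-out-of-6 nor invariance under homotopy
   equivalence. *)

Set Implicit Arguments.
Unset Strict Implicit.
Unset Printing Implicit Defensive.

Import Order.TTheory GRing.Theory Num.Theory.
Local Open Scope ring_scope.
Local Open Scope cat_scope.

(** * Additive categories *)

Arguments comp {c X Y Z} g f : simpl never.
Arguments idm {c} X : simpl never.
Arguments Hom {c} X Y : simpl never.

Section Additive.
Variable A : add_category.
Implicit Types X Y Z W : A.

(** [Q_-] gives no control over the transition maps of the tower [G_n X], and [F], being merely
    additive, need not respect limits along epimorphisms that do not split; this forces the passage
    to [R_n]. The complexes [R_n] need not lie in [B], but the inclusion [G_n -> R_n] is degreewise
    split with a split acyclic cokernel, a situation that any additive functor preserves. The towers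
    [F G_n L] are there for naturality. A weak equivalence [L -> L'] between values of [Q] is an
    arbitrary chain map, not one of the form [Q f], so it induces nothing on the towers [R_n X],
    which depend on [X] and not on [L]. The construction [G_n] applies to it, and this is why [L] is
    fed into [G_n] a second time. *)

Lemma compBl X Y Z (g h : Hom Y Z) (f : Hom X Y) :
  (g - h) ∘ f = g ∘ f - h ∘ f.
Proof. by rewrite compDl compNm. Qed.

Lemma compBr X Y Z (g : Hom Y Z) (f h : Hom X Y) :
  g ∘ (f - h) = g ∘ f - g ∘ h.
Proof. by rewrite compDr compmN. Qed.

(** [locked] keeps simplification from exposing the sum, so that pairs are handled through their
    projections only. *)
Definition pair W X Y (f : Hom W X) (g : Hom W Y) : Hom W (biprod X Y) :=
  locked (bin1 X Y ∘ f + bin2 X Y ∘ g).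

Lemma pr1_pair W X Y (f : Hom W X) (g : Hom W Y) : bpr1 X Y ∘ pair f g = f.
Proof. by rewrite /pair -lock compDr !compA bpr1in1 bpr1in2 comp0m comp1m addr0. Qed.

Lemma pr2_pair W X Y (f : Hom W X) (g : Hom W Y) : bpr2 X Y ∘ pair f g = g.
Proof. by rewrite /pair -lock compDr !compA bpr2in1 bpr2in2 comp0m comp1m add0r. Qed.

Lemma pair_ext W X Y (f g : Hom W (biprod X Y)) :
  bpr1 X Y ∘ f = bpr1 X Y ∘ g -> bpr2 X Y ∘ f = bpr2 X Y ∘ g -> f = g.
Proof.
move=> e1 e2; rewrite -[f]comp1m -[g]comp1m -bsum !compDl -!compA.
by rewrite e1 e2.
Qed.

Section Assoc.
Variables (V W X Y X' Y' : A).

(** Once composites are associated to the left, a redex such as [bpr1 ∘ pair] is hidden behind a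
    prefix [k]; hence these variants. *)
Lemma pr1_pairA (k : Hom X V) (f : Hom W X) (g : Hom W Y) :
  k ∘ bpr1 X Y ∘ pair f g = k ∘ f.
Proof. by rewrite -compA pr1_pair. Qed.

Lemma pr2_pairA (k : Hom Y V) (f : Hom W X) (g : Hom W Y) :
  k ∘ bpr2 X Y ∘ pair f g = k ∘ g.
Proof. by rewrite -compA pr2_pair. Qed.

Lemma tri_pr1A (k : Hom X' V) (a : Hom X X') (b : Hom X Y') (c : Hom Y Y') :
  k ∘ bpr1 X' Y' ∘ tri a b c = k ∘ a ∘ bpr1 X Y.
Proof. by rewrite -compA tri_pr1 compA. Qed.

Lemma tri_pr2A (k : Hom Y' V) (a : Hom X X') (b : Hom X Y') (c : Hom Y Y') :
  k ∘ bpr2 X' Y' ∘ tri a b c = k ∘ b ∘ bpr1 X Y + k ∘ c ∘ bpr2 X Y.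
Proof. by rewrite -compA tri_pr2 compDr !compA. Qed.

Lemma bpr1in1A (k : Hom X V) : k ∘ bpr1 X Y ∘ bin1 X Y = k.
Proof. by rewrite -compA bpr1in1 compm1. Qed.

Lemma bpr2in2A (k : Hom Y V) : k ∘ bpr2 X Y ∘ bin2 X Y = k.
Proof. by rewrite -compA bpr2in2 compm1. Qed.

Lemma bpr1in2A (k : Hom X V) : k ∘ bpr1 X Y ∘ bin2 X Y = 0.
Proof. by rewrite -compA bpr1in2 compm0. Qed.

Lemma bpr2in1A (k : Hom Y V) : k ∘ bpr2 X Y ∘ bin1 X Y = 0.
Proof. by rewrite -compA bpr2in1 compm0. Qed.

End Assoc.

Definition bpE := (pr1_pair, pr2_pair, pr1_pairA, pr2_pairA, tri_pr1, tri_pr2,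
  tri_pr1A, tri_pr2A, bpr1in1, bpr2in2, bpr1in2, bpr2in1, bpr1in1A, bpr2in2A,
  bpr1in2A, bpr2in1A, (@compA A), (@comp1m A), (@compm1 A), (@comp0m A), (@compm0 A),
  (@compDl A), (@compDr A), (@compNm A), (@compmN A)).

Definition addE := (addr0, add0r, oppr0, opprD, addrA).

Lemma comp_pair V W X Y (f : Hom W X) (g : Hom W Y) (h : Hom V W) :
  pair f g ∘ h = pair (f ∘ h) (g ∘ h).
Proof. by apply: pair_ext; rewrite !bpE. Qed.

Lemma tri_pair W X X' Y Y' (a : Hom X X') (b : Hom X Y') (c : Hom Y Y')
    (f : Hom W X) (g : Hom W Y) :
  tri a b c ∘ pair f g = pair (a ∘ f) (b ∘ f + c ∘ g).
Proof. by apply: pair_ext; rewrite !bpE. Qed.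

Lemma pair_eta W X Y (f : Hom W (biprod X Y)) :
  pair (bpr1 X Y ∘ f) (bpr2 X Y ∘ f) = f.
Proof. by apply: pair_ext; rewrite !bpE. Qed.

Lemma tri_id X Y : tri (idm X) 0 (idm Y) = idm (biprod X Y).
Proof. by apply: pair_ext; rewrite !bpE ?addE. Qed.

Lemma biprod_zero X Y : is_zero X -> is_zero Y -> is_zero (biprod X Y).
Proof.
rewrite /is_zero => X0 Y0; rewrite -bsum.
rewrite -[bpr1 X Y]comp1m X0 comp0m compm0.
by rewrite -[bpr2 X Y]comp1m Y0 comp0m compm0 addr0.
Qed.

Lemma to_zero X Y (f : Hom X Y) : is_zero Y -> f = 0.
Proof. by rewrite /is_zero => Y0; rewrite -[f]comp1m Y0 comp0m. Qed.

Definition is_mono X Y (i : Hom X Y) : Prop :=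
  forall W (a b : Hom W X), i ∘ a = i ∘ b -> a = b.

Lemma mono_eq0 X Y (i : Hom X Y) W (a : Hom W X) :
  is_mono i -> i ∘ a = 0 -> a = 0.
Proof. by move=> im ia; apply: im; rewrite ia compm0. Qed.

Lemma mono_of_eq0 X Y (i : Hom X Y) :
  (forall W (a : Hom W X), i ∘ a = 0 -> a = 0) -> is_mono i.
Proof.
by move=> i0 W a b ab; apply/eqP; rewrite -subr_eq0; apply/eqP/i0;
  rewrite compBr ab subrr.
Qed.

Lemma mono_comp X Y Z (i : Hom X Y) (j : Hom Y Z) :
  is_mono i -> is_mono j -> is_mono (j ∘ i).
Proof. by move=> im jm W a b; rewrite -!compA => /jm /im. Qed.

Lemma mono_of_comp X Y Z (i : Hom X Y) (j : Hom Y Z) :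
  is_mono (j ∘ i) -> is_mono i.
Proof. by move=> m W a b ab; apply: m; rewrite -!compA ab. Qed.

Lemma kernel_mono X Y Z (i : Hom X Y) (p : Hom Y Z) : is_kernel i p -> is_mono i.
Proof.
move=> [pi0 ker] W a b ab.
have [|k [_ uk]] := ker W (i ∘ a); first by rewrite compA pi0 comp0m.
by rewrite -(uk a erefl) -(uk b (esym ab)).
Qed.

Lemma kernel_lift X Y Z (i : Hom X Y) (p : Hom Y Z) W (h : Hom W Y) :
  is_kernel i p -> p ∘ h = 0 -> exists k, i ∘ k = h.
Proof. by move=> [_ ker] /ker [k [ik _]]; exists k. Qed.

Lemma kernelI X Y Z (i : Hom X Y) (p : Hom Y Z) :
  p ∘ i = 0 -> is_mono i ->
  (forall W (h : Hom W Y), p ∘ h = 0 -> exists k, i ∘ k = h) -> is_kernel i p.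
Proof.
move=> pi0 im lift; split=> // W h /lift [k ik]; exists k; split=> // k' ik'.
by apply: im; rewrite ik ik'.
Qed.

Lemma kernel_comp_mono X Y Z Z' (i : Hom X Y) (p : Hom Y Z) (j : Hom Z Z') :
  is_mono j -> is_kernel i p -> is_kernel i (j ∘ p).
Proof.
move=> jm ker; apply: kernelI; last 1 first.
- by move=> W h jph; apply: (kernel_lift ker); apply: (mono_eq0 jm); rewrite compA.
- by rewrite -compA ker.1 compm0.
- exact: kernel_mono ker.
Qed.

Lemma kernel_of_comp_mono X Y Z Z' (i : Hom X Y) (p : Hom Y Z) (j : Hom Z Z') :
  is_mono j -> is_kernel i (j ∘ p) -> is_kernel i p.
Proof.
move=> jm ker; apply: kernelI; last 1 first.
- by move=> W h ph; apply: (kernel_lift ker); rewrite -compA ph compm0.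
- by apply: (mono_eq0 jm); rewrite compA ker.1.
- exact: kernel_mono ker.
Qed.

Lemma kernel_unique X X' Y Z (i : Hom X Y) (i' : Hom X' Y) (p : Hom Y Z) :
  is_kernel i p -> is_kernel i' p -> exists a : Hom X X', is_iso a /\ i' ∘ a = i.
Proof.
move=> ker ker'.
have [a ia] := kernel_lift ker' ker.1; have [b ib] := kernel_lift ker ker'.1.
exists a; split=> //; exists b; split.
  by apply: (kernel_mono ker); rewrite compA ib ia compm1.
by apply: (kernel_mono ker'); rewrite compA ia ib compm1.
Qed.

Definition is_epi X Y (p : Hom X Y) : Prop :=
  forall W (a b : Hom Y W), a ∘ p = b ∘ p -> a = b.

Lemma cokernel_epi X Y Z (i : Hom X Y) (p : Hom Y Z) : is_cokernel i p -> is_epi p.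
Proof.
move=> [pi0 cok] W a b ab.
have [|k [_ uk]] := cok W (a ∘ p); first by rewrite -compA pi0 compm0.
by rewrite -(uk a erefl) -(uk b (esym ab)).
Qed.

Lemma cokernel_desc X Y Z (i : Hom X Y) (p : Hom Y Z) W (h : Hom Y W) :
  is_cokernel i p -> h ∘ i = 0 -> exists k, k ∘ p = h.
Proof. by move=> [_ cok] /cok [k [ik _]]; exists k. Qed.

Lemma cokernel_unique X Y Z Z' (i : Hom X Y) (p : Hom Y Z) (p' : Hom Y Z') :
  is_cokernel i p -> is_cokernel i p' ->
  exists a : Hom Z Z', is_iso a /\ a ∘ p = p'.
Proof.
move=> cok cok'.
have [a ap] := cokernel_desc cok cok'.1.
have [b bp] := cokernel_desc cok' cok.1.
exists a; split=> //; exists b; split.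
  by apply: (cokernel_epi cok); rewrite -compA ap bp comp1m.
by apply: (cokernel_epi cok'); rewrite -compA bp ap comp1m.
Qed.

Lemma is_iso_id X : is_iso (idm X).
Proof. by exists (idm X); rewrite comp1m. Qed.

End Additive.

(** * Exact categories *)

Section Exact.
Variable E : exact_category.
Implicit Types X Y Z W : E.

Lemma ses_kernel X Y Z (i : Hom X Y) (p : Hom Y Z) : ses i p -> is_kernel i p.
Proof. exact: (conf_kernel (sesP E)). Qed.

Lemma ses_cokernel X Y Z (i : Hom X Y) (p : Hom Y Z) : ses i p -> is_cokernel i p.
Proof. exact: (conf_cokernel (sesP E)). Qed.

Lemma ses_adm_epi X Y Z (i : Hom X Y) (p : Hom Y Z) : ses i p -> adm_epi p.
Proof. by exists X, i. Qed.

Lemma ses_adm_mono X Y Z (i : Hom X Y) (p : Hom Y Z) : ses i p -> adm_mono i.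
Proof. by exists Z, p. Qed.

Lemma ses_comp0 X Y Z (i : Hom X Y) (p : Hom Y Z) : ses i p -> p ∘ i = 0.
Proof. by move/ses_kernel => []. Qed.

Lemma ses_mono X Y Z (i : Hom X Y) (p : Hom Y Z) : ses i p -> is_mono i.
Proof. by move/ses_kernel/kernel_mono. Qed.

Lemma adm_epi_epi Y Z (p : Hom Y Z) : adm_epi p -> is_epi p.
Proof. by move=> [X [i /ses_cokernel/cokernel_epi]]. Qed.

Lemma ses_of_kernel X Y Z (i : Hom X Y) (p : Hom Y Z) :
  adm_epi p -> is_kernel i p -> ses i p.
Proof.
move=> [X' [i' s]] ker.
have [a [aiso ia]] := kernel_unique (ses_kernel s) ker.
apply: (conf_iso (sesP E) aiso (is_iso_id Y) (is_iso_id Z) _ _ s).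
  by rewrite comp1m ia.
by rewrite comp1m compm1.
Qed.

Lemma ses_of_cokernel X Y Z (i : Hom X Y) (p : Hom Y Z) :
  adm_mono i -> is_cokernel i p -> ses i p.
Proof.
move=> [X' [i' s]] cok.
have [a [aiso ia]] := cokernel_unique (ses_cokernel s) cok.
apply: (conf_iso (sesP E) (is_iso_id X) (is_iso_id Y) aiso _ _ s).
  by rewrite comp1m compm1.
by rewrite compm1 ia.
Qed.

Lemma adm_epi_id_map X : adm_epi (idm X).
Proof. exact: (adm_epi_id (sesP E)). Qed.

Lemma adm_epi_compose X Y Z (p : Hom X Y) (q : Hom Y Z) :
  adm_epi p -> adm_epi q -> adm_epi (q ∘ p).
Proof. exact: (adm_epi_comp (sesP E)). Qed.

(** The cokernel of the admissible monomorphism [idm X] is a zero object, and all zero objects are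
    isomorphic. *)
Lemma adm_epi_to_zero X Z (f : Hom X Z) : is_zero Z -> adm_epi f.
Proof.
move=> Z0; have [Z' [p s]] := adm_mono_id (sesP E) X.
have p0 : p = 0 by rewrite -[p]compm1 (ses_comp0 s).
have Z'0 : is_zero Z'.
  by apply: (cokernel_epi (ses_cokernel s)); rewrite p0 compm0 comp0m.
exists X, (idm X).
apply: (conf_iso (sesP E) (is_iso_id X) (is_iso_id X) (c := 0 : Hom Z' Z) _ _ _ s).
- exists (0 : Hom Z Z'); split; first by rewrite comp0m [in RHS]Z'0.
  by rewrite comp0m [in RHS]Z0.
- by rewrite compm1.
- by rewrite p0 compm1 (to_zero f Z0) comp0m.
Qed.

Lemma adm_epi_iso_comp X X' Y (p : Hom X Y) (a : Hom X' X) :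
  is_iso a -> adm_epi p -> adm_epi (p ∘ a).
Proof.
move=> [b [ba ab]] [K [i s]]; exists K, (b ∘ i).
apply: (conf_iso (sesP E) (is_iso_id K) (b := b) _ (is_iso_id Y) _ _ s).
- by exists a.
- by rewrite compm1.
- by rewrite -compA ab comp1m compm1.
Qed.

(** The biproduct is the pullback of [X -> 0] and [Y -> 0], so this is stability of admissible
    epimorphisms under pullback. *)
Lemma adm_epi_bpr2 X Y : adm_epi (bpr2 X Y).
Proof.
have Z0 : is_zero (azero E : E) by exact: azeroP.
have [P [p' [f' [[sq pb] ep]]]] := adm_epi_pullback (sesP E) (0 : Hom Y (azero E))
  (adm_epi_to_zero (0 : Hom X (azero E)) Z0).
have [|k [[k1 k2] _]] := pb _ (bpr1 X Y) (bpr2 X Y); first by rewrite !comp0m.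
rewrite -k2; apply: adm_epi_iso_comp => //.
exists (pair f' p'); split; last first.
  have [|k' [_ uk]] := pb _ f' p'; first by rewrite !comp0m.
  rewrite -(uk (idm P)); last by rewrite !compm1.
  apply/esym/uk; split; first by rewrite compA k1 pr1_pair.
  by rewrite compA k2 pr2_pair.
by rewrite comp_pair k1 k2; apply: pair_ext; rewrite !bpE.
Qed.

Lemma ses_bin1 X Y : ses (bin1 X Y) (bpr2 X Y).
Proof.
apply: ses_of_kernel; first exact: adm_epi_bpr2.
apply: kernelI.
- exact: bpr2in1.
- by move=> W a b /(congr1 (comp (bpr1 X Y))); rewrite !bpE.
- move=> W h h0; exists (bpr1 X Y ∘ h).
  by apply: pair_ext; rewrite !bpE // h0.
Qed.

Lemma split_exact_ses X Y Z (f : Hom X Y) (g : Hom Y Z) :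
  split_exact f g -> ses f g.
Proof.
move=> [r [s [rf gs gf rs fr]]].
apply: (conf_iso (sesP E) (is_iso_id X) (b := f ∘ bpr1 X Z + s ∘ bpr2 X Z) _
  (is_iso_id Z) _ _ (ses_bin1 X Z)).
- exists (pair r g); split.
    by apply: pair_ext; rewrite !bpE ?rf ?rs ?gf ?gs !bpE ?addE.
  by rewrite !bpE fr.
- by rewrite !bpE ?addE.
- by rewrite !bpE gf gs !bpE ?addE.
Qed.

(** Replaces the choice of a preimage in diagram chases with generalized elements: the preimage
    exists after passing to a cover [c]. *)
Lemma pullback_cover Y Z W (p : Hom Y Z) (w : Hom W Z) :
  adm_epi p -> exists W' (c : Hom W' W) (v : Hom W' Y), adm_epi c /\ p ∘ v = w ∘ c.
Proof.
move=> ep; have [P [p' [f' [[sq _] ep']]]] := adm_epi_pullback (sesP E) w ep.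
by exists P, p', f'.
Qed.

(** As [m] is mono, [u] kills the kernel of [c], and [c] is the cokernel of that kernel; so [u]
    descends. *)
Lemma adm_epi_lift_mono X Y W W' (m : Hom X Y) (c : Hom W' W) (w : Hom W Y)
    (u : Hom W' X) :
  is_mono m -> adm_epi c -> m ∘ u = w ∘ c -> exists v, m ∘ v = w.
Proof.
move=> mm ec mu; have [K [k s]] := ec.
have uk : u ∘ k = 0.
  by apply: (mono_eq0 mm); rewrite compA mu -compA (ses_comp0 s) compm0.
have [v vc] := cokernel_desc (ses_cokernel s) uk.
by exists v; apply: (adm_epi_epi ec); rewrite -compA vc mu.
Qed.

Lemma kernel_of_local X Y Z (m : Hom X Y) (g : Hom Y Z) :
  is_mono m -> g ∘ m = 0 ->
  (forall W (w : Hom W Y), g ∘ w = 0 ->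
     exists W' (c : Hom W' W) (u : Hom W' X), adm_epi c /\ m ∘ u = w ∘ c) ->
  is_kernel m g.
Proof.
move=> mm gm loc; apply: kernelI => // W w /loc [W' [c [u [ec mu]]]].
exact: (adm_epi_lift_mono mm ec mu).
Qed.

Section WeaklyIdempotentComplete.
Hypothesis wic : weakly_idempotent_complete E.

(** In the pullback [P] of [q ∘ p] and [q], the projection [r] to [X] has the section [s], so weak
    idempotent completeness gives it a kernel, which maps by [e] to a kernel [k] of [q]. This [k] is
    a pushout of the admissible monomorphism [nu], hence admissible, and [q] is its cokernel. *)
Lemma adm_epi_of_comp X Y Z (p : Hom X Y) (q : Hom Y Z) :
  adm_epi (q ∘ p) -> adm_epi q.
Proof.
move=> eqp; have [N [nu sqp]] := eqp.
have [P [e [r [[sq pb] ee]]]] := adm_epi_pullback (sesP E) q eqp.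
have [s [[rs es] _]] : exists! k, r ∘ k = idm X /\ e ∘ k = p.
  by apply: pb; rewrite compm1.
have [K [kap kerr]] := wic rs.
have rkap := kerr.1.
set k := e ∘ kap.
have qk : q ∘ k = 0 by rewrite compA -sq -compA rkap compm0.
have kerq : is_kernel k q.
  apply: kernelI => //.
    move=> W a b; rewrite -!compA => ab; apply: (kernel_mono kerr).
    have [|x [_ ux]] := pb _ (0 : Hom W X) (e ∘ (kap ∘ a)).
      by rewrite compm0 (compA e) (compA q) -/k qk comp0m.
    rewrite -(ux (kap ∘ a)); last by rewrite compA rkap comp0m.
    by apply: ux; rewrite compA rkap comp0m ab.
  move=> W h qh.
  have [|x [[rx ex] _]] := pb _ (0 : Hom W X) h; first by rewrite compm0.
  have [y ky] := kernel_lift kerr rx; exists y.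
  by rewrite -compA ky.
have [phi kphi] : exists phi, k ∘ phi = p ∘ nu.
  by apply: (kernel_lift kerq); rewrite compA (ses_comp0 sqp).
have [rho krho] : exists rho, kap ∘ rho = idm P - s ∘ r.
  by apply: (kernel_lift kerr); rewrite compBr compm1 compA rs comp1m subrr.
have rhos : rho ∘ s = 0.
  apply: (mono_eq0 (kernel_mono kerr)).
  by rewrite compA krho compBl comp1m -compA rs compm1 subrr.
have rhok : rho ∘ kap = idm K.
  apply: (kernel_mono kerr).
  by rewrite compA krho compBl comp1m -compA rkap compm0 subr0 compm1.
(* The pushout of [nu] along [phi] is [Y], because it is the cokernel of
   [(nu, - phi)], i.e. of the kernel of the admissible epimorphism [e]. *)
have po : is_pushout nu phi k p.
  split=> // W a b ab.
  have [K' [j sj]] := ee.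
  have [|t [te _]] := (ses_cokernel sj).2 W (a ∘ r + b ∘ rho).
    have [|n nun] := kernel_lift (ses_kernel sqp) (h := r ∘ j).
      by rewrite compA sq -compA (ses_comp0 sj) compm0.
    have kr : k ∘ (rho ∘ j) = - (k ∘ (phi ∘ n)).
      rewrite compA -(compA e) krho compBr compm1 compA es compBl (ses_comp0 sj).
      by rewrite -compA -nun compA -kphi -compA sub0r.
    rewrite compDl -!compA -nun compA ab.
    have -> : rho ∘ j = - (phi ∘ n).
      by apply: (kernel_mono kerq); rewrite kr compmN.
    by rewrite compmN compA subrr.
  exists t; split; first split.
  - by rewrite -es compA te compDl -!compA rs rhos compm1 compm0 addr0.
  - by rewrite compA te compDl -!compA rkap rhok compm1 compm0 add0r.
  move=> t' [tp tk]; apply: (adm_epi_epi ee); rewrite te.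
  rewrite -[t' ∘ e]compm1 -[idm P](subrK (s ∘ r)) -krho compDr !compA.
  by rewrite -(compA t') tk -(compA t') es tp addrC.
(* The axiom provides some pushout with an admissible [i']; uniqueness of pushouts carries this over
   to [k]. *)
have [Y' [i' [f' [po' mi']]]] := adm_mono_pushout (sesP E) phi (ses_adm_mono sqp).
have [h [[hf hi] _]] := po'.2 _ p k po.1.
have [h' [[hp hk] _]] := po.2 _ f' i' po'.1.
have hisoh : is_iso h.
  exists h'; split.
    have [x [_ ux]] := po'.2 _ f' i' po'.1.
    rewrite -(ux (idm Y')); last by rewrite !comp1m.
    by apply/esym/ux; rewrite -!compA hf hi hp hk.
  have [x [_ ux]] := po.2 _ p k po.1.
  rewrite -(ux (idm Y)); last by rewrite !comp1m.
  by apply/esym/ux; rewrite -!compA hp hk hf hi.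
have mk : adm_mono k.
  have [C [g sg]] := mi'; have [l [lh hl]] := hisoh; exists C, (g ∘ l).
  apply: (conf_iso (sesP E) (is_iso_id K) hisoh (is_iso_id C) _ _ sg).
    by rewrite hi compm1.
  by rewrite -compA lh comp1m compm1.
exists K, k; apply: ses_of_cokernel => //; split=> // W w wk.
have [|t [tqp _]] := (ses_cokernel sqp).2 W (w ∘ p).
  by rewrite -compA -kphi compA wk comp0m.
exists t; split.
  have [x [_ ux]] := po.2 W (w ∘ p) (0 : Hom K W) (etrans (esym (compA w p nu))
     (etrans (congr1 (comp w) (esym kphi)) (etrans (compA w k phi)
     (congr1 (fun z => z ∘ phi) wk)))).
  rewrite -(ux w); last by [].
  by apply/esym/ux; rewrite -!compA qk compm0 tqp.
by move=> t' t'q; apply: (adm_epi_epi eqp); rewrite tqp compA t'q.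
Qed.

End WeaklyIdempotentComplete.
End Exact.

(** * The opposite exact category, for dual statements *)

Section Opposite.

Definition op_add (A : add_category) : add_category :=
  @AddCategory (aob A) (fun X Y => ahom Y X) (@aid A)
    (fun X Y Z g f => acomp f g)
    (fun X Y Z W h g f => esym (acompA f g h))
    (fun X Y f => acompm1 f) (fun X Y f => acomp1m f)
    (fun X Y Z g h f => acompDr f g h) (fun X Y Z g f h => acompDl f h g)
    (azero A) (azeroP A) (@abiprod A) (@abpr1 A) (@abpr2 A) (@abin1 A) (@abin2 A)
    (@abpr1in1 A) (@abpr2in2 A) (@abpr2in1 A) (@abpr1in2 A) (@absum A).

Variable E : exact_category.

Definition op_ses (X Y Z : op_add E) (i : Hom X Y) (p : Hom Y Z) : Prop :=
  @ses E Z Y X p i.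

Lemma op_iso (X Y : op_add E) (f : Hom X Y) : is_iso f -> @is_iso E Y X f.
Proof. by move=> [g [gf fg]]; exists g; split. Qed.

Lemma op_sesP : exact_structure op_ses.
Proof.
have S := sesP E; split.
- by move=> X Y Z i p /(conf_cokernel S).
- by move=> X Y Z i p /(conf_kernel S).
- move=> X Y Z X' Y' Z' i p i' p' a b c /op_iso [a' [aa' a'a]]
    /op_iso [b' [bb' b'b]] /op_iso [c' [cc' c'c]] bi cp s.
  apply: (@conf_iso _ _ S Z Y X Z' Y' X' p i p' i' c' b' a' _ _ _ _ _ s).
  + by exists c.
  + by exists b.
  + by exists a.
  + have e : @comp E _ _ _ p c = @comp E _ _ _ b p' by exact: cp.
    have -> : @comp E _ _ _ b' p =
      @comp E _ _ _ b' (@comp E _ _ _ (@comp E _ _ _ p c) c').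
      by rewrite -compA c'c compm1.
    by rewrite e !compA bb' comp1m.
  + have e : @comp E _ _ _ i b = @comp E _ _ _ a i' by exact: bi.
    have -> : @comp E _ _ _ a' i =
      @comp E _ _ _ a' (@comp E _ _ _ (@comp E _ _ _ i b) b').
      by rewrite -compA b'b compm1.
    by rewrite e !compA aa' comp1m.
- exact: (adm_epi_id S).
- exact: (adm_mono_id S).
- by move=> X Y Z i j ei ej; apply: (@adm_epi_comp _ _ S Z Y X j i ej ei).
- by move=> X Y Z i j ei ej; apply: (@adm_mono_comp _ _ S Z Y X j i ej ei).
- by move=> X Y X' i f; apply: (@adm_epi_pullback _ _ S Y X X' i f).
- by move=> X Y X' i f; apply: (@adm_mono_pushout _ _ S Y X X' i f).
Qed.

Definition op_exact : exact_category := ExactCategory op_sesP.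

Hypothesis wic : weakly_idempotent_complete E.

(** Kernels of retractions yield cokernels of sections: [idm X - s ∘ r] factors through the kernel
    [k] of [r] by a map [rho], and [rho] is a cokernel of [s]. *)
Lemma op_wic : weakly_idempotent_complete op_exact.
Proof.
move=> X Y s r rs.
have {}rs : @comp E _ _ _ r s = idm Y by exact: rs.
have [K [k ker]] := wic rs.
have [rho krho] : exists rho : @Hom E X K,
  @comp E _ _ _ k rho = idm X - @comp E _ _ _ s r.
  by apply: (kernel_lift ker); rewrite compBr compm1 compA rs comp1m subrr.
exists K, rho; split.
  apply: (mono_eq0 (kernel_mono ker)).
  by rewrite compA krho compBl comp1m -compA rs compm1 subrr.
move=> W h hs.
have {}hs : @comp E _ _ _ h s = 0 by exact: hs.
have rhok : @comp E _ _ _ rho k = idm K.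
  apply: (kernel_mono ker).
  by rewrite compA krho compBl comp1m -compA ker.1 compm0 subr0 compm1.
exists (@comp E _ _ _ h k); split.
  change (@comp E _ _ _ (@comp E _ _ _ h k) rho = h).
  by rewrite -compA krho compBr compm1 compA hs comp0m subr0.
move=> h' hh'.
have {}hh' : @comp E _ _ _ h' rho = h by exact: hh'.
by rewrite -hh' -compA rhok compm1.
Qed.

Lemma adm_mono_of_comp (X Y Z : E) (i : Hom X Y) (j : Hom Y Z) :
  adm_mono (j ∘ i) -> adm_mono i.
Proof. exact: (@adm_epi_of_comp op_exact op_wic Z Y X j i). Qed.

End Opposite.

(** * Acyclic complexes *)

Lemma dep_choice (I : Type) (T : I -> Type) (P : forall i, T i -> Prop) :
  (forall i, exists x, P i x) -> exists f : forall i, T i, forall i, P i (f i).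
Proof.
by move=> h; exists (fun i => projT1 (cid (h i))) => i; apply: projT2 (cid (h i)).
Qed.

Section Reindexing.
Variable A : add_category.

Definition xcast (X : int -> A) m n (e : m = n) : Hom (X m) (X n) :=
  match e in _ = k return Hom (X m) (X k) with erefl => idm (X m) end.

(* The differential with a free target index, which avoids rewriting inside
   types when [n + 1 - 1] has to be identified with [n]. *)
Definition dd (X : complex A) m n (e : n = m - 1) : Hom (X m) (X n) :=
  locked (xcast X (esym e) ∘ cd X m).

Lemma dd_erefl (X : complex A) m : dd X (erefl (m - 1)) = cd X m.
Proof. by rewrite /dd -lock comp1m. Qed.

Lemma cm_dd (X Y : complex A) (f : chain_map X Y) m n (e : n = m - 1) :
  f n ∘ dd X e = dd Y e ∘ f m.
Proof. by subst n; rewrite !dd_erefl cmd. Qed.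

Lemma cd_dd (X : complex A) m n (e : n = m - 1) : cd X n ∘ dd X e = 0.
Proof. by subst n; rewrite !dd_erefl cdd. Qed.

End Reindexing.

Section Acyclic.
Variable E : exact_category.
Implicit Types X Y Z : complex E.

Definition has_cycles X : Prop :=
  forall n, exists (K : E) (i : Hom K (X n)), is_kernel i (cd X n).

(* Exactness for generalized elements: a cycle becomes a boundary after
   pulling back along an admissible epimorphism. *)
Definition locally_exact X : Prop :=
  forall m n (e : n = m - 1) (W : E) (w : Hom W (X n)), cd X n ∘ w = 0 ->
  exists W' (c : Hom W' W) (v : Hom W' (X m)), adm_epi c /\ dd X e ∘ v = w ∘ c.

Lemma acyclic_cycles X : acyclic X -> exists (Z : int ->
  E) (i : forall n, Hom (Z n) (X n)),
  forall n, is_kernel (i n) (cd X n) /\ adm_mono (i n).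
Proof.
move=> [Z [i [p H]]]; exists Z, i => n; have [s dip] := H n; split.
  rewrite dip; apply: kernel_comp_mono; last exact: ses_kernel.
  by have [/ses_mono] := H (n - 1).
exact: ses_adm_mono s.
Qed.

Lemma acyclic_has_cycles X : acyclic X -> has_cycles X.
Proof. by move=> /acyclic_cycles [Z [i H]] n; exists (Z n), (i n); case: (H n). Qed.

Lemma acyclic_locally_exact X : acyclic X -> locally_exact X.
Proof.
move=> [Z [i [p H]]] m n e W w; subst n => dw; rewrite dd_erefl.
have [s dip] := H m; have [s' dip'] := H (m - 1).
have [|w' iw'] := kernel_lift (ses_kernel s') (h := w).
  have [s'' _] := H (m - 1 - 1).
  by apply: (mono_eq0 (ses_mono s'')); rewrite compA -dip'.
have [W' [c [v [ec pv]]]] := pullback_cover w' (ses_adm_epi s).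
by exists W', c, v; split=> //; rewrite dip -compA pv compA iw'.
Qed.

Hypothesis wic : weakly_idempotent_complete E.

Lemma adm_epi_of_local (X Y W : E) (p : Hom X Y) (c : Hom W Y) (v : Hom W X) :
  adm_epi c -> p ∘ v = c -> adm_epi p.
Proof. by move=> ec pv; apply: (adm_epi_of_comp wic (p := v)); rewrite pv. Qed.

Lemma adm_epi_split (X Y : E) (p : Hom X Y) (s : Hom Y X) :
  p ∘ s = idm Y -> adm_epi p.
Proof. exact/adm_epi_of_local/adm_epi_id_map. Qed.

(** Separates what an exact category does not give for free, the existence of cycles, from what a
    chase can check. Local exactness applied to the inclusion of the cycles lifts a cover of them
    along [p], which makes [p] an admissible epimorphism. *)
Lemma acyclicP X : has_cycles X -> locally_exact X -> acyclic X.
Proof.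
move=> /dep_choice [Z /dep_choice [i ker]] ex.
have /dep_choice [p ip] : forall n, exists p, i (n - 1) ∘ p = cd X n.
  by move=> n; apply: (kernel_lift (ker (n - 1))); apply: cdd.
exists Z, i, p => n; split=> //.
have im : is_mono (i (n - 1)) := kernel_mono (ker (n - 1)).
apply: ses_of_kernel; last by apply: (kernel_of_comp_mono im); rewrite ip.
have [W' [c [v [ec dv]]]] := ex _ _ erefl _ (i (n - 1)) (ker (n - 1)).1.
apply: (adm_epi_of_local (v := v) ec); apply: im.
by rewrite compA ip -dv dd_erefl.
Qed.

Lemma ses_tri (X Y Z X' Y' Z' : E) (i : Hom X Y) (p : Hom Y Z) (i' : Hom X' Y')
    (p' : Hom Y' Z') : ses i p -> ses i' p' -> ses (tri i 0 i') (tri p 0 p').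
Proof.
move=> s s'; apply: ses_of_kernel.
  have [W1 [c1 [v1 [ec1 pv1]]]] := pullback_cover (bpr1 Z Z') (ses_adm_epi s).
  have [W2 [c2 [v2 [ec2 pv2]]]] :=
    pullback_cover (bpr2 Z Z' ∘ c1) (ses_adm_epi s').
  apply: (adm_epi_of_local (c := c1 ∘ c2) (v := pair (v1 ∘ c2) v2)).
    exact: adm_epi_compose.
  by rewrite tri_pair; apply: pair_ext; rewrite !bpE ?addE // pv1.
apply: kernelI.
- by rewrite tri_comp (ses_comp0 s) (ses_comp0 s') compm0 comp0m addr0 tri0.
- apply: mono_of_eq0 => W a; rewrite -(pair_eta a) tri_pair => h.
  have /(congr1 (comp (bpr1 Y Y'))) := h;
    rewrite !bpE -compA => /(mono_eq0 (ses_mono s)) ->.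
  have /(congr1 (comp (bpr2 Y Y'))) := h; rewrite !bpE ?addE -compA.
  move=> /(mono_eq0 (ses_mono s')) ->.
  by apply: pair_ext; rewrite !bpE.
- move=> W h; rewrite -(pair_eta h) tri_pair => ph.
  have /(congr1 (comp (bpr1 Z Z'))) := ph; rewrite !bpE -compA.
  move=> /(kernel_lift (ses_kernel s)) [k ik].
  have /(congr1 (comp (bpr2 Z Z'))) := ph; rewrite !bpE ?addE -compA.
  move=> /(kernel_lift (ses_kernel s')) [k' ik'].
  exists (pair k k'); rewrite tri_pair ik ik'.
  by apply: pair_ext; rewrite !bpE ?addE.
Qed.

(** * Two-out-of-three for acyclicity in a short exact sequence of complexes *)

Section ShortExactSequence.
Variables (X Y Z : complex E) (f : chain_map X Y) (g : chain_map Y Z).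
Hypothesis sfg : forall n, ses (f n) (g n).

Let fm n : is_mono (f n). Proof. exact: ses_mono (sfg n). Qed.
Let gf0 n : g n ∘ f n = 0. Proof. exact: ses_comp0 (sfg n). Qed.

(** For the cycles of [Y], let [Y1] be the pullback of the cycles of [Z] along [g]. The differential
    sends [Y1] to cycles of [X] by a map [eps], which is an admissible epimorphism because these
    cycles are boundaries in [X]; its kernel is the object sought. *)
Lemma acyclic_middle : acyclic X -> acyclic Z -> acyclic Y.
Proof.
move=> aX aZ; have eX := acyclic_locally_exact aX.
have eZ := acyclic_locally_exact aZ; apply: acyclicP.
  move=> n.
  have [ZX [iX kX]] := acyclic_has_cycles aX (n - 1).
  have [ZZ [iZ kZ]] := acyclic_has_cycles aZ n.
  have [Y1 [q [j [[sq pb] _]]]] := adm_epi_pullback (sesP E) iZ (ses_adm_epi (sfg n)).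
  have jm : is_mono j.
    apply: mono_of_eq0 => W a ja.
    have [|k [_ uk]] := pb W 0 0; first by rewrite !compm0.
    rewrite -(uk a); first by rewrite (uk 0) // !compm0.
    split=> //; apply: (mono_eq0 (kernel_mono kZ)).
    by rewrite compA -sq -compA ja compm0.
  have [delta fdelta] : exists delta, f (n - 1) ∘ delta = cd Y n ∘ j.
    apply: (kernel_lift (ses_kernel (sfg (n - 1)))).
    by rewrite compA -cmd -compA sq compA kZ.1 comp0m.
  have [eps ieps] : exists eps, iX ∘ eps = delta.
    apply: (kernel_lift kX); apply: (mono_eq0 (@fm _)).
    by rewrite compA -cmd -compA fdelta compA cdd comp0m.
  have eeps : adm_epi eps.
    have [W [c [x [ec dx]]]] := eX _ _ erefl _ iX kX.1.
    rewrite dd_erefl in dx.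
    have [|y [[jy qy] _]] := pb W (f n ∘ x) 0.
      by rewrite compA gf0 comp0m compm0.
    apply: (adm_epi_of_local (v := y) ec).
    apply: (kernel_mono kX); apply: (@fm _).
    by rewrite (compA iX) ieps compA fdelta -compA jy compA cmd -dx compA.
  have [K [k sk]] := eeps.
  exists K, (j ∘ k); apply: kernelI.
  - by rewrite compA -fdelta -ieps -!compA (ses_comp0 sk) !compm0.
  - exact: mono_comp (ses_mono sk) jm.
  - move=> W h dh.
    have [|z iz] := kernel_lift kZ (h := g n ∘ h).
      by rewrite compA cmd -compA dh compm0.
    have [y [[jy qy] _]] := pb W h z (esym iz).
    have [|x kx] := kernel_lift (ses_kernel sk) (h := y).
      apply: (mono_eq0 (kernel_mono kX)); apply: (mono_eq0 (@fm _)).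
      by rewrite (compA iX) ieps compA fdelta -compA jy.
    by exists x; rewrite -compA kx.
move=> m n e W y; subst n => dy; rewrite dd_erefl.
have [|W1 [c1 [z [ec1 dz]]]] := eZ _ _ erefl _ (g (m - 1) ∘ y).
  by rewrite compA cmd -compA dy compm0.
rewrite dd_erefl in dz.
have [W2 [c2 [y' [ec2 gy']]]] := pullback_cover z (ses_adm_epi (sfg m)).
have [|x fx] := kernel_lift (ses_kernel (sfg (m - 1)))
  (h := y ∘ c1 ∘ c2 - cd Y m ∘ y').
  by rewrite compBr !compA -dz -cmd -!compA gy' subrr.
have [|W3 [c3 [x' [ec3 dx']]]] := eX _ _ erefl _ x.
  apply: (mono_eq0 (@fm _)); rewrite compA -cmd -compA fx compBr !compA dy cdd.
  by rewrite !comp0m subrr.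
rewrite dd_erefl in dx'.
exists W3, (c1 ∘ c2 ∘ c3), (y' ∘ c3 + f m ∘ x'); split.
  by do !apply: adm_epi_compose.
by rewrite compDr (compA _ (f m)) cmd -(compA (f _)) dx' (compA (f _)) fx compBl !compA
  [LHS]addrC subrK.
Qed.

(** The cycles of [X] are the kernel of the map [gam] from the cycles of [Y] to those of [Z]. It is
    an admissible epimorphism: a cycle of [Z] is locally a boundary [d z], and a lift of [z] to [Y]
    has as differential a cycle above it. *)
Lemma acyclic_left : acyclic Y -> acyclic Z -> acyclic X.
Proof.
move=> aY aZ; have eY := acyclic_locally_exact aY.
have eZ := acyclic_locally_exact aZ; apply: acyclicP.
  move=> n.
  have [ZY [iY kY]] := acyclic_has_cycles aY n.
  have [ZZ [iZ kZ]] := acyclic_has_cycles aZ n.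
  have [gam igam] : exists gam, iZ ∘ gam = g n ∘ iY.
    by apply: (kernel_lift kZ); rewrite compA cmd -compA kY.1 compm0.
  have egam : adm_epi gam.
    have [W1 [c1 [z [ec1 dz]]]] := eZ _ _ (esym (addrK 1 n)) _ iZ kZ.1.
    have [W2 [c2 [y [ec2 gy]]]] := pullback_cover z (ses_adm_epi (sfg (n + 1))).
    have [|y' iy'] := kernel_lift kY (h := dd Y (esym (addrK 1 n)) ∘ y).
      by rewrite compA cd_dd comp0m.
    apply: (adm_epi_of_local (c := c1 ∘ c2) (v := y')).
      exact: adm_epi_compose.
    apply: (kernel_mono kZ).
    by rewrite compA igam -compA iy' compA cm_dd -compA gy !compA dz.
  have [K [k sk]] := egam.
  have [m fmk] : exists m, f n ∘ m = iY ∘ k.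
    apply: (kernel_lift (ses_kernel (sfg n))).
    by rewrite compA -igam -compA (ses_comp0 sk) compm0.
  exists K, m; apply: kernelI.
  - apply: (mono_eq0 (@fm _)).
    by rewrite compA -cmd -compA fmk compA kY.1 comp0m.
  - apply: (mono_of_comp (j := f n)); rewrite fmk.
    exact: mono_comp (ses_mono sk) (kernel_mono kY).
  - move=> W h dh.
    have [|y iy] := kernel_lift kY (h := f n ∘ h).
      by rewrite compA cmd -compA dh compm0.
    have [|x kx] := kernel_lift (ses_kernel sk) (h := y).
      apply: (mono_eq0 (kernel_mono kZ)).
      by rewrite compA igam -compA iy compA gf0 comp0m.
    by exists x; apply: (@fm _); rewrite compA fmk -compA kx iy.
move=> m n e W x; subst n => dx; rewrite dd_erefl.
have [|W1 [c1 [y [ec1 dy]]]] := eY _ _ erefl _ (f (m - 1) ∘ x).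
  by rewrite compA cmd -compA dx compm0.
rewrite dd_erefl in dy.
have [|W2 [c2 [z [ec2 dz]]]] := eZ _ _ (esym (addrK 1 m)) _ (g m ∘ y).
  by rewrite compA cmd -compA dy !compA gf0 !comp0m.
have [W3 [c3 [y' [ec3 gy']]]] := pullback_cover z (ses_adm_epi (sfg (m + 1))).
have [|x' fx'] := kernel_lift (ses_kernel (sfg m))
  (h := y ∘ c2 ∘ c3 - dd Y (esym (addrK 1 m)) ∘ y').
  by rewrite compBr (compA _ (dd _ _)) cm_dd -(compA _ _ y') gy' !compA dz subrr.
exists W3, (c1 ∘ c2 ∘ c3), x'; split; first by do !apply: adm_epi_compose.
apply: (@fm _).
by rewrite compA -cmd -(compA (cd Y m)) fx' compBr !compA cd_dd comp0m subr0 dy.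
Qed.

(** The cycles of [Z] are the cokernel of the map [phi] from the cycles of [X] to those of [Y]. Its
    admissibility comes from the dual cancellation law, since [iY ∘ phi] is the admissible
    monomorphism [f n ∘ iX]; that the cokernel gives all cycles is [lift], by which cycles of [Z]
    come locally from cycles of [Y]. *)
Lemma acyclic_right : acyclic X -> acyclic Y -> acyclic Z.
Proof.
move=> aX aY; have eX := acyclic_locally_exact aX.
have eY := acyclic_locally_exact aY.
have lift n W (z : Hom W (Z n)) : cd Z n ∘ z = 0 ->
    exists W' (c : Hom W' W) (y : Hom W' (Y n)),
    [/\ adm_epi c, cd Y n ∘ y = 0 & g n ∘ y = z ∘ c].
  move=> dz; have [W1 [c1 [y [ec1 gy]]]] := pullback_cover z (ses_adm_epi (sfg n)).
  have [|x fx] := kernel_lift (ses_kernel (sfg (n - 1))) (h := cd Y n ∘ y).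
    by rewrite compA -cmd -compA gy compA dz comp0m.
  have [|W2 [c2 [x' [ec2 dx']]]] := eX _ _ erefl _ x.
    by apply: (mono_eq0 (@fm _)); rewrite compA -cmd -compA fx compA cdd comp0m.
  rewrite dd_erefl in dx'.
  exists W2, (c1 ∘ c2), (y ∘ c2 - f n ∘ x'); split.
  - exact: adm_epi_compose.
  - by rewrite compBr !compA cmd -(compA (f _)) dx' -fx compA subrr.
  - by rewrite compBr !compA gf0 comp0m subr0 gy.
apply: acyclicP; last first.
  move=> m n e W z; subst n => dz; rewrite dd_erefl.
  have [W1 [c1 [y [ec1 dy gy]]]] := lift _ _ _ dz.
  have [W2 [c2 [y' [ec2 dy']]]] := eY _ _ erefl _ y dy.
  rewrite dd_erefl in dy'.
  exists W2, (c1 ∘ c2), (g m ∘ y'); split; first exact: adm_epi_compose.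
  by rewrite compA cmd -compA dy' !compA gy.
move=> n.
have [ZX' [iX' HX]] := acyclic_cycles aX.
have [ZY' [iY' HY]] := acyclic_cycles aY.
have [kX mX] := HX n; have [kY mY] := HY n.
move: (ZX' n) (iX' n) (ZY' n) (iY' n) kX mX kY mY => {ZX' iX' HX ZY' iY' HY}.
move=> ZX iX ZY iY kX mX kY mY.
have [phi iphi] : exists phi, iY ∘ phi = f n ∘ iX.
  by apply: (kernel_lift kY); rewrite compA cmd -compA kX.1 compm0.
have [C [q sq]] : adm_mono phi.
  apply: (adm_mono_of_comp wic (j := iY)); rewrite iphi.
  exact: (adm_mono_comp (sesP E) mX (ses_adm_mono (sfg n))).
have [m mq] : exists m, m ∘ q = g n ∘ iY.
  apply: (cokernel_desc (ses_cokernel sq)).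
  by rewrite -compA iphi compA gf0 comp0m.
exists C, m; apply: kernel_of_local.
- apply: mono_of_eq0 => W w mw.
  have [W1 [c [y [ec qy]]]] := pullback_cover w (ses_adm_epi sq).
  have [|x fx] := kernel_lift (ses_kernel (sfg n)) (h := iY ∘ y).
    by rewrite compA -mq -compA qy compA mw comp0m.
  have [|x' ix'] := kernel_lift kX (h := x).
    by apply: (mono_eq0 (@fm _)); rewrite compA -cmd -compA fx compA kY.1 comp0m.
  have yx : y = phi ∘ x'.
    by apply: (kernel_mono kY); rewrite compA iphi -compA ix' fx.
  apply: (adm_epi_epi ec).
  by rewrite -qy yx compA (ses_comp0 sq) !comp0m.
- apply: (cokernel_epi (ses_cokernel sq)).
  by rewrite -compA mq compA cmd -compA kY.1 compm0 comp0m.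
- move=> W z /lift [W' [c [y [ec dy gy]]]].
  have [y' iy'] := kernel_lift kY dy.
  by exists W', c, (q ∘ y'); split=> //; rewrite compA mq -compA iy'.
Qed.

End ShortExactSequence.
End Acyclic.

(** * Cones and weak equivalences *)

Section Cones.
Variable A : add_category.

Lemma shift_dd (X : complex A) n :
  (- cd X (n - 1 - 1)) ∘ (- cd X (n - 1)) = 0.
Proof. by rewrite compNm compmN cdd !oppr0. Qed.

Definition shift (X : complex A) : complex A :=
  @Complex A (fun n => X (n - 1)) (fun n => - cd X (n - 1)) (shift_dd X).

Lemma shift_map_cmd (X Y : complex A) (f : chain_map X Y) n :
  cd (shift Y) n ∘ f (n - 1) = f (n - 1 - 1) ∘ cd (shift X) n.
Proof. by rewrite /= compNm compmN cmd. Qed.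

Definition shift_map (X Y : complex A) (f : chain_map X Y) :
  chain_map (shift X) (shift Y) := @ChainMap A (shift X) (shift Y) (fun n => f (n - 1))
    (shift_map_cmd f).

Section ConeSequence.
Variables (X Y : complex A) (f : chain_map X Y).

Lemma cone_in_cmd n :
  cd (cone f) n ∘ bin2 (X (n - 1)) (Y n) = bin2 (X (n - 1 - 1)) (Y (n - 1)) ∘ cd Y n.
Proof. by apply: pair_ext; rewrite /= !bpE ?addE. Qed.

Definition cone_in : chain_map Y (cone f) :=
  @ChainMap A Y (cone f) (fun n => bin2 _ _) cone_in_cmd.

Lemma cone_out_cmd n :
  cd (shift X) n ∘ bpr1 (X (n - 1)) (Y n) = bpr1 (X (n - 1 - 1)) (Y (n - 1)) ∘ cd (cone
    f) n.
Proof. by rewrite /= !bpE. Qed.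

Definition cone_out : chain_map (cone f) (shift X) :=
  @ChainMap A (cone f) (shift X) (fun n => bpr1 _ _) cone_out_cmd.

End ConeSequence.

Section ConeMap.
Variables (X Y X' Y' : complex A) (f : chain_map X Y) (f' : chain_map X' Y').
Variables (a : chain_map X X') (b : chain_map Y Y').
Hypothesis sq : forall n, b n ∘ f n = f' n ∘ a n.

Lemma cone_map_cmd n : cd (cone f') n ∘ tri (a (n - 1)) 0 (b n) =
  tri (a (n - 1 - 1)) 0 (b (n - 1)) ∘ cd (cone f) n.
Proof.
by rewrite /= /cone_d !tri_comp compNm compmN !cmd sq compm0 comp0m add0r addr0.
Qed.

Definition cone_map : chain_map (cone f) (cone f') :=
  @ChainMap A (cone f) (cone f') (fun n => tri (a (n - 1)) 0 (b n)) cone_map_cmd.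

End ConeMap.

Section ToCone.
Variables (L P Q : complex A) (iota : chain_map L P) (v : chain_map P Q).
Hypothesis viota : forall n, v n ∘ iota n = 0.

Lemma to_cone_cmd n :
  cd (cone v) n ∘ (bin1 (P (n - 1)) (Q n) ∘ iota (n - 1)) =
  bin1 (P (n - 1 - 1)) (Q (n - 1)) ∘ iota (n - 1 - 1) ∘ cd (shift L) n.
Proof.
by apply: pair_ext; rewrite /= /cone_d !bpE ?cmd // viota oppr0 addr0.
Qed.

(** The cone of [v] is the suspension of its homotopy fibre; this is the suspended comparison of a
    kernel with that fibre. *)
Definition to_cone : chain_map (shift L) (cone v) :=
  @ChainMap A (shift L) (cone v) (fun n => bin1 _ _ ∘ iota (n - 1)) to_cone_cmd.

End ToCone.

Lemma tri_opp (X X' Y Y' : A) (a : Hom X X') (b : Hom X Y') (c : Hom Y Y') :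
  - tri a b c = tri (- a) (- b) (- c).
Proof. by apply: pair_ext; rewrite !bpE // opprD. Qed.

Lemma is_iso_unipotent (X : A) (N : Hom X X) : N ∘ N = 0 -> is_iso (idm X + N).
Proof.
move=> NN; exists (idm X - N); split.
  by rewrite compBl !compDr !comp1m compm1 NN addr0 addrK.
by rewrite compBr !compDl !comp1m compm1 NN addr0 addrK.
Qed.

End Cones.

(** The objects [Z n] belong to the data because idempotents need not split: a contracting homotopy
    alone might not produce them. Unlike acyclicity, this is preserved by every additive functor. *)
Definition split_acyclic (A : add_category) (X : complex A) : Prop :=
  exists (Z : int -> A) (i : forall n, Hom (Z n) (X n))
    (p : forall n, Hom (X n) (Z (n - 1))),
    forall n, split_exact (i n) (p n) /\ cd X n = i (n - 1) ∘ p n.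

Section WeakEquivalences.
Variable E : exact_category.

Lemma split_acyclic_acyclic (X : complex E) : split_acyclic X -> acyclic X.
Proof.
move=> [Z [i [p H]]]; exists Z, i, p => n; have [s dip] := H n.
by split=> //; apply: split_exact_ses.
Qed.

(** A cycle [(x, y)] of the cone satisfies [f x + d y = 0], so it is determined by [y]; the cycles
    in degree [n] are therefore [Y n]. *)
Lemma weak_equiv_iso (X Y : complex E) (f : chain_map X Y) :
  (forall n, is_iso (f n)) -> weak_equiv f.
Proof.
move=> /dep_choice [g fg]; apply: split_acyclic_acyclic.
exists Y, (fun n => pair (- (g (n - 1) ∘ cd Y n)) (idm (Y n))),
  (fun n => f (n - 1) ∘ bpr1 _ _ + cd Y n ∘ bpr2 _ _) => n; split.
  have [gf fg'] := fg (n - 1).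
  exists (bpr2 _ _), (bin1 _ _ ∘ g (n - 1)); split.
  - by rewrite !bpE.
  - by rewrite !bpE fg' ?addE.
  - by rewrite !bpE fg' !bpE addNr.
  - by rewrite !bpE.
  - by apply: pair_ext; rewrite !bpE ?addE ?gf ?bpE //= [LHS]addrAC addNr add0r.
have [gf _] := fg (n - 1 - 1).
have gd : g (n - 1 - 1) ∘ cd Y (n - 1) ∘ f (n - 1) = cd X (n - 1).
  by rewrite -compA cmd compA gf comp1m.
apply: pair_ext; rewrite /= /cone_d !bpE ?addE // gd.
by rewrite -(compA (g _)) cdd !bpE oppr0 addr0.
Qed.

Lemma weak_equiv_id (X : complex E) : weak_equiv (ch_id X).
Proof. by apply: weak_equiv_iso => n; apply: is_iso_id. Qed.

Lemma ses_bin2 (X Y : E) : ses (bin2 X Y) (bpr1 X Y).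
Proof.
apply: split_exact_ses; exists (bpr2 X Y), (bin1 X Y); split; rewrite ?bpE //.
by rewrite addrC bsum.
Qed.

Lemma ses_bin2N (X Y : E) : ses (bin2 X Y) (- bpr1 X Y).
Proof.
apply: split_exact_ses; exists (bpr2 X Y), (- bin1 X Y).
by split; rewrite ?bpE ?opprK ?bpE ?oppr0 // addrC bsum.
Qed.

Lemma acyclic_shift (X : complex E) : acyclic X -> acyclic (shift X).
Proof.
move=> [Z [i [p H]]].
exists (fun n => Z (n - 1)), (fun n => i (n - 1)), (fun n => - p (n - 1)) => n.
have [s dip] := H (n - 1); split; last by rewrite compmN -dip.
apply: (conf_iso (sesP E) (is_iso_id _) (is_iso_id _) (c := - idm _) _ _ _ s).
- by exists (- idm _); rewrite !bpE opprK.
- by rewrite !bpE.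
- by rewrite !bpE.
Qed.

Hypothesis wic : weakly_idempotent_complete E.

Lemma acyclic_unshift (X : complex E) : acyclic (shift X) -> acyclic X.
Proof.
move=> aX; apply: (acyclicP wic).
  (* [acyclicP] leaves a statement about one degree at a time, in which [n] can be replaced by
     [n + 1 - 1], a degree that [shift X] controls. *)
  move=> n; rewrite -(addrK 1 n).
  have [K [i ker]] := acyclic_has_cycles aX (n + 1).
  exists K, i; apply: kernelI.
  - by apply: oppr_inj; rewrite oppr0 -compNm ker.1.
  - exact: kernel_mono ker.
  - by move=> W h dh; apply: (kernel_lift ker); rewrite compNm dh oppr0.
have ex m W (w : Hom W (X (m - 1 - 1))) : cd X (m - 1 - 1) ∘ w = 0 ->
    exists W' (c : Hom W' W) (v : Hom W' (X (m - 1))),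
    adm_epi c /\ cd X (m - 1) ∘ v = w ∘ c.
  move=> dw; have [|W' [c [v [ec dv]]]] := acyclic_locally_exact aX (erefl (m - 1)) (w
    := w).
    by rewrite /= compNm dw oppr0.
  exists W', c, (- v); split=> //.
  by rewrite compmN -dv dd_erefl compNm.
move=> m n e W; subst n; rewrite -(addrK 1 m) => w dw.
by rewrite dd_erefl; apply: ex.
Qed.

Section Cone2of3.
Variables (X Y : complex E) (f : chain_map X Y).

Lemma weak_equiv_of_acyclic : acyclic X -> acyclic Y -> weak_equiv f.
Proof.
move=> aX aY; apply: (acyclic_middle wic (f := cone_in f) (g := cone_out f)) => //.
- by move=> n; apply: ses_bin2.
- exact: acyclic_shift.
Qed.

Lemma acyclic_target : weak_equiv f -> acyclic X -> acyclic Y.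
Proof.
move=> we aX; apply: (acyclic_left wic (f := cone_in f) (g := cone_out f)) => //.
- by move=> n; apply: ses_bin2.
- exact: acyclic_shift.
Qed.

Lemma acyclic_source : weak_equiv f -> acyclic Y -> acyclic X.
Proof.
move=> we aY; apply: acyclic_unshift.
apply: (acyclic_right wic (f := cone_in f) (g := cone_out f)) => //.
by move=> n; apply: ses_bin2.
Qed.

End Cone2of3.

Section ConeMap2of3.
Variables (X Y X' Y' : complex E) (f : chain_map X Y) (f' : chain_map X' Y').
Variables (a : chain_map X X') (b : chain_map Y Y').
Hypothesis sq : forall n, b n ∘ f n = f' n ∘ a n.

Lemma cone_map_in_cmd n : cd (cone (cone_map sq)) n ∘ tri (bin2 _ _) 0 (bin2 _ _) =
  tri (bin2 _ _) 0 (bin2 _ _) ∘ cd (cone b) n.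
Proof.
rewrite /= /cone_d !tri_comp compm0 comp0m addr0 add0r; congr tri.
- by apply: pair_ext; rewrite !bpE ?oppr0 ?addE.
- by apply: pair_ext; rewrite /= !bpE ?addE.
- by apply: pair_ext; rewrite !bpE ?addE.
Qed.

Definition cone_map_in : chain_map (cone b) (cone (cone_map sq)) :=
  @ChainMap E (cone b) (cone (cone_map sq)) (fun n => tri (bin2 _ _) 0 (bin2 _ _))
    cone_map_in_cmd.

Lemma cone_map_out_cmd n : cd (shift (cone a)) n ∘ tri (bpr1 _ _) 0 (- bpr1 _ _) =
  tri (bpr1 _ _) 0 (- bpr1 _ _) ∘ cd (cone (cone_map sq)) n.
Proof.
rewrite /= /cone_d tri_opp !tri_comp; congr tri.
- by rewrite !bpE.
- by rewrite /= !bpE ?addE.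
- by rewrite !bpE.
Qed.

(** The iterated cone is an extension of [shift (cone a)] by [cone b]. In the iterated cone [a]
    enters with a plus sign, in [shift (cone a)] with a minus sign, whence the sign here. *)
Definition cone_map_out : chain_map (cone (cone_map sq)) (shift (cone a)) :=
  @ChainMap E (cone (cone_map sq)) (shift (cone a))
    (fun n => tri (bpr1 _ _) 0 (- bpr1 _ _)) cone_map_out_cmd.

Lemma cone_map_ses n : ses (cone_map_in n) (cone_map_out n).
Proof. exact: (ses_tri wic (ses_bin2 _ _) (ses_bin2N _ _)). Qed.

Lemma weak_equiv_cone_map : weak_equiv a -> weak_equiv b -> weak_equiv (cone_map sq).
Proof.
move=> wa wb; apply: (acyclic_middle wic cone_map_ses) => //.
exact: acyclic_shift.
Qed.

Lemma weak_equiv_cone_map_right :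
  weak_equiv a -> weak_equiv (cone_map sq) -> weak_equiv b.
Proof.
by move=> wa wm; apply: (acyclic_left wic cone_map_ses wm); apply: acyclic_shift.
Qed.

End ConeMap2of3.

Section Composition.
Variables (X Y Z : complex E) (f : chain_map X Y) (g : chain_map Y Z)
  (h : chain_map X Z).
Hypothesis gfh : forall n, g n ∘ f n = h n.

(** With the identity of [X] and [g] as its sides, this square gives a map [cone f -> cone h].
    Two-out-of-three for [f], [g], [h] is then read off from that map, using that it is a weak
    equivalence if and only if [g] is. *)
Let sq n : g n ∘ f n = h n ∘ ch_id X n.
Proof. by rewrite gfh compm1. Qed.

Lemma weak_equiv_comp : weak_equiv f -> weak_equiv g -> weak_equiv h.
Proof.
move=> wf wg; apply: (@acyclic_target _ _ (cone_map sq)) wf.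
exact: weak_equiv_cone_map (weak_equiv_id X) wg.
Qed.

Lemma weak_equiv_cancel_source : weak_equiv f -> weak_equiv h -> weak_equiv g.
Proof.
move=> wf wh; apply: (weak_equiv_cone_map_right (sq := sq) (weak_equiv_id X)).
exact: weak_equiv_of_acyclic.
Qed.

Lemma weak_equiv_cancel_target : weak_equiv g -> weak_equiv h -> weak_equiv f.
Proof.
move=> wg wh; apply: (@acyclic_source _ _ (cone_map sq)) wh.
exact: weak_equiv_cone_map (weak_equiv_id X) wg.
Qed.

End Composition.

Section Shift.
Variables (X Y : complex E) (f : chain_map X Y).

Lemma cone_shift_cmd n : cd (cone (shift_map f)) n ∘ tri (idm _) 0 (- idm _) =
  tri (idm _) 0 (- idm _) ∘ cd (shift (cone f)) n.
Proof.
by rewrite /= /cone_d tri_opp !tri_comp; congr tri; rewrite /= ?bpE ?addE ?opprK.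
Qed.

Definition cone_shift : chain_map (shift (cone f)) (cone (shift_map f)) :=
  @ChainMap E (shift (cone f)) (cone (shift_map f))
    (fun n => tri (idm _) 0 (- idm _)) cone_shift_cmd.

Lemma weak_equiv_cone_shift : weak_equiv cone_shift.
Proof.
apply: weak_equiv_iso => n; exists (tri (idm _) 0 (- idm _)).
by rewrite !tri_comp !bpE opprK addr0 tri_id.
Qed.

Lemma weak_equiv_shift : weak_equiv f -> weak_equiv (shift_map f).
Proof.
by move=> wf; apply: (acyclic_target weak_equiv_cone_shift); apply: acyclic_shift.
Qed.

Lemma weak_equiv_unshift : weak_equiv (shift_map f) -> weak_equiv f.
Proof.
by move=> wf; apply: acyclic_unshift; apply: acyclic_source weak_equiv_cone_shift _.
Qed.

End Shift.

Section AcyclicCokernel.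
Variables (X Y Z : complex E) (f : chain_map X Y) (g : chain_map Y Z).
Hypothesis sfg : forall n, ses (f n) (g n).

Lemma cone_quotient_cmd n : cd Z n ∘ (g n ∘ bpr2 (X (n - 1)) (Y n)) =
  (g (n - 1) ∘ bpr2 (X (n - 1 - 1)) (Y (n - 1))) ∘ cd (cone f) n.
Proof.
by rewrite /= /cone_d !bpE cmd (ses_comp0 (sfg _)) !bpE add0r.
Qed.

(** The cone of [f] is an extension of [Z] by the cone of the identity of [X]. *)
Lemma weak_equiv_acyclic_cokernel : acyclic Z -> weak_equiv f.
Proof.
have sq n : f n ∘ ch_id X n = f n ∘ ch_id X n by [].
move=> aZ; apply: (acyclic_middle wic (f := cone_map sq)
  (g := @ChainMap E (cone f) Z (fun n => g n ∘ bpr2 (X (n - 1)) (Y n))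
    cone_quotient_cmd) _ (weak_equiv_id X) aZ) => n.
apply: ses_of_kernel => /=.
  apply: adm_epi_compose; first exact: adm_epi_bpr2.
  exact: ses_adm_epi (sfg n).
apply: kernelI.
- by rewrite !bpE (ses_comp0 (sfg n)) !bpE addr0.
- apply: mono_of_eq0 => W a; rewrite -(pair_eta a) tri_pair => h.
  have /(congr1 (comp (bpr1 _ _))) := h; rewrite !bpE => ->.
  have /(congr1 (comp (bpr2 _ _))) := h; rewrite !bpE add0r -compA.
  by move=> /(mono_eq0 (ses_mono (sfg n))) ->; apply: pair_ext; rewrite !bpE.
- move=> W h; rewrite -compA => /(kernel_lift (ses_kernel (sfg n))) [k fk].
  exists (pair (bpr1 _ _ ∘ h) k); rewrite tri_pair fk.
  by apply: pair_ext; rewrite !bpE ?add0r.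
Qed.

End AcyclicCokernel.

Section ShiftedKernel.
Variables (L P Q : complex E) (iota : chain_map L P) (v : chain_map P Q).
Hypothesis viota : forall n, v n ∘ iota n = 0.

(** The cokernel of [shift L -> cone v] is the cone of the identity of [Q], which is acyclic. *)
Lemma weak_equiv_to_cone :
  (forall n, ses (iota n) (v n)) -> weak_equiv (to_cone viota).
Proof.
move=> siv; have sq n : ch_id Q n ∘ v n = ch_id Q n ∘ v n by [].
apply: (weak_equiv_acyclic_cokernel (g := cone_map sq)) (weak_equiv_id Q) => n.
have s0 : ses (0 : Hom (azero E : E) (Q n)) (idm (Q n)).
  apply: ses_of_kernel; first exact: adm_epi_id_map.
  apply: kernelI; first by rewrite compm0.
    by move=> W a b _; rewrite [a]to_zero ?[b]to_zero //; apply: azeroP.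
  by move=> W h; rewrite comp1m => ->; exists 0; rewrite compm0.
apply: ses_of_kernel.
  exact: ses_adm_epi (ses_tri wic (siv (n - 1)) s0).
apply: kernelI => /=.
- by apply: pair_ext; rewrite !bpE ?addE // viota.
- apply: mono_comp (ses_mono (siv _)) _ => W a b.
  by move=> /(congr1 (comp (bpr1 _ _))); rewrite !bpE.
- move=> W h; rewrite -(pair_eta h) tri_pair => e.
  have /(congr1 (comp (bpr1 _ _))) := e; rewrite !bpE -compA.
  move=> /(kernel_lift (ses_kernel (siv _))) [k ik].
  have /(congr1 (comp (bpr2 _ _))) := e; rewrite !bpE add0r => e2.
  by exists k; apply: pair_ext; rewrite !bpE ?e2 // ik.
Qed.

End ShiftedKernel.

Section Interleaving.
Variables (P' P : complex E) (phi : chain_map P' P) (sigma : chain_map P P')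
  (u' : chain_map P' P') (u : chain_map P P).
Hypothesis sq : forall n, phi n ∘ u' n = u n ∘ phi n.
Hypothesis u'E : forall n, u' n = idm _ - sigma n ∘ phi n.
Hypothesis uE : forall n, u n = idm _ - phi n ∘ sigma n.

Let sq1 n : phi n ∘ ch_id P' n = ch_id P n ∘ phi n.
Proof. by rewrite /= compm1 comp1m. Qed.

Let N n : Hom (cone (cone_map sq1) n) (cone (cone_map sq) n) :=
  bin1 _ _ ∘ bin2 _ _ ∘ sigma (n - 1) ∘ bpr1 _ _ ∘ bpr2 _ _.

(* Adding [sigma c] to the second coordinate turns the cone of [cone 1 -> cone 1]
   into the cone of [cone u' -> cone u]. *)
Lemma interleaving_cmd n : cd (cone (cone_map sq)) n ∘ (idm _ + N n) =
  (idm _ + N (n - 1)) ∘ cd (cone (cone_map sq1)) n.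
Proof.
apply: pair_ext; apply: pair_ext; rewrite /= /N /cone_d !bpE ?u'E ?uE ?bpE ?addE
  /= /cone_ob ?opprK //.
- by rewrite cmd; congr (_ + _); rewrite [LHS]addrAC.
- by rewrite [LHS]addrAC subrK.
Qed.

(** The cones of the two identities are acyclic, hence so is the cone of the map between them, and
    the unipotent isomorphism transports this. Nothing is assumed about [phi] being a weak
    equivalence. *)
Lemma weak_equiv_interleaved : weak_equiv (cone_map sq).
Proof.
apply: (@acyclic_target _ _ (@ChainMap E (cone (cone_map sq1)) (cone (cone_map sq))
  (fun n => idm _ + N n) interleaving_cmd)).
  apply: weak_equiv_iso => n.
  by apply: (@is_iso_unipotent E (cone (cone_map sq) n) (N n)); rewrite /N !bpE.
by apply: weak_equiv_of_acyclic; exact: weak_equiv_id.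
Qed.

End Interleaving.
End WeakEquivalences.

(** * Countable products and towers *)

Section Products.
Variables (C : category) (I : Type) (X : I -> C) (P : C) (p : forall i, Hom P (X i)).
Hypothesis pP : is_product p.

Lemma product_lift W (w : forall i, Hom W (X i)) : exists u, forall i, p i ∘ u = w i.
Proof. by have [u [pu _]] := pP w; exists u. Qed.

Lemma product_ext W (a b : Hom W P) : (forall i, p i ∘ a = p i ∘ b) -> a = b.
Proof.
move=> ab; have [u [_ uu]] := pP (fun i => p i ∘ b).
by rewrite -(uu a ab) -(uu b).
Qed.

End Products.

Lemma productI (C : category) (I : Type) (X : I ->
  C) (P : C) (p : forall i, Hom P (X i)) :
  (forall W (w : forall i, Hom W (X i)), exists u, forall i, p i ∘ u = w i) ->
  (forall W (a b : Hom W P), (forall i, p i ∘ a = p i ∘ b) -> a = b) -> is_product p.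
Proof.
move=> lift ext W w; have [u pu] := lift W w; exists u; split=> // v pv.
by apply: ext => i; rewrite pu pv.
Qed.

Section PartialSums.
Variable A : add_category.

(** Coelementarity speaks of towers only, so a countable product is obtained as the limit of its
    finite partial products, whose transition maps are split. *)
Fixpoint psum (X : nat -> A) n : A :=
  if n is m.+1 then biprod (psum X m) (X m) else azero A.

Fixpoint psum_map (X Y : nat -> A) (f : forall n, Hom (X n) (Y n)) n :
    Hom (psum X n) (psum Y n) :=
  if n is m.+1 then tri (psum_map f m) 0 (f m) else idm (azero A : A).

Fixpoint psum_lift (X : nat -> A) W (w : forall n, Hom W (X n)) n : Hom W (psum X n) :=
  if n is m.+1 then pair (psum_lift w m) (w m) else 0.

Definition psum_tower (X : nat -> A) : tower A :=
  @Tower A (psum X) (fun n => bpr1 (psum X n) (X n)).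

Lemma psum0_zero (X : nat -> A) W (a b : Hom W (psum X 0)) : a = b.
Proof. by rewrite [a]to_zero 1?[b]to_zero //; apply: azeroP. Qed.

Lemma product_psum_limit (X : nat -> A) (P : A) (p : forall n, Hom P (X n)) :
  is_product p -> is_tower_limit (X := psum_tower X) (psum_lift p).
Proof.
move=> pP; split=> [n /=|W w cw]; first by rewrite pr1_pair.
have [u pu] := product_lift pP (fun n => bpr2 (psum X n) (X n) ∘ w n.+1).
exists u; split=> [|u' wu'].
  elim=> [|n IHn /=]; first exact: psum0_zero.
  rewrite comp_pair IHn pu -(cw n) /=; exact: pair_eta.
apply: (product_ext pP) => n; rewrite pu -wu' /=.
by rewrite compA pr2_pair.
Qed.

Lemma psum_limit_product (X : nat -> A) (P : A) (q : forall n, Hom P (psum X n)) :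
  is_tower_limit (X := psum_tower X) q ->
  is_product (fun n => bpr2 (psum X n) (X n) ∘ q n.+1).
Proof.
move=> [cq lq] W w; have [|u [qu uu]] := lq W (psum_lift w).
  by move=> n /=; rewrite pr1_pair.
exists u; split=> [n|u' qu']; first by rewrite -compA (qu n.+1) /= pr2_pair.
apply: uu; elim=> [|n IHn /=]; first exact: psum0_zero.
apply: pair_ext; last by rewrite pr2_pair compA qu'.
by rewrite pr1_pair -IHn -(cq n) /= -compA.
Qed.

Section OneMinusTransition.
Variables (X : nat -> A) (t : forall n, Hom (X n.+1) (X n)).

(* [one_minus n] maps [(x_0, ..., x_n)] to [(x_i - t x_(i+1))_(i < n)]; its kernel
   is [X n], embedded by [x |-> (..., t t x, t x, x)]. *)
Fixpoint one_minus n : Hom (psum X n.+1) (psum X n) :=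
  if n is m.+1 then
    pair (one_minus m ∘ bpr1 _ _) (bpr2 _ _ ∘ bpr1 _ _ - t m ∘ bpr2 _ _)
  else 0.

Fixpoint thread n : Hom (X n) (psum X n.+1) :=
  if n is m.+1 then pair (thread m ∘ t m) (idm (X m.+1)) else pair 0 (idm (X 0)).

(** The new last coordinate is set to [0], which forces the one before it to be the last entry of
    the right-hand side. The value found by recursion is corrected along [thread], which leaves the
    earlier equations intact. *)
Fixpoint one_minus_section n : Hom (psum X n) (psum X n.+1) :=
  if n is m.+1 then
    pair (one_minus_section m ∘ bpr1 _ _ +
      thread m ∘ (bpr2 _ _ - bpr2 _ _ ∘ (one_minus_section m ∘ bpr1 _ _))) 0
  else 0.

Lemma thread_last n : bpr2 (psum X n) (X n) ∘ thread n = idm (X n).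
Proof. by case: n => [|n]; rewrite /= pr2_pair. Qed.

Lemma thread_init n : bpr1 (psum X n.+1) (X n.+1) ∘ thread n.+1 = thread n ∘ t n.
Proof. by rewrite /= pr1_pair. Qed.

Lemma one_minus_thread n : one_minus n ∘ thread n = 0.
Proof.
elim: n => [|n IHn]; first by rewrite comp0m.
have E1 := thread_last n; have E2 := thread_init n; have E3 := thread_last n.+1.
have -> : one_minus n.+1 = pair (one_minus n ∘ bpr1 _ _)
  (bpr2 _ _ ∘ bpr1 _ _ - t n ∘ bpr2 _ _) by [].
rewrite comp_pair compBl -!compA E2 E3 (compA (one_minus n)) IHn (compA (bpr2 _ _)) E1.
by apply: pair_ext; rewrite !bpE // subrr.
Qed.

Lemma one_minusK n : one_minus n ∘ one_minus_section n = idm (psum X n).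
Proof.
elim: n => [|n IHn]; first exact: psum0_zero.
have -> : one_minus n.+1 = pair (one_minus n ∘ bpr1 _ _)
  (bpr2 _ _ ∘ bpr1 _ _ - t n ∘ bpr2 _ _) by [].
have -> : one_minus_section n.+1 = pair (one_minus_section n ∘ bpr1 _ _ +
  thread n ∘ (bpr2 _ _ - bpr2 _ _ ∘ (one_minus_section n ∘ bpr1 _ _))) 0 by [].
have [k kE] : exists k, k = bpr2 _ _ - bpr2 _ _ ∘ (one_minus_section n ∘ bpr1 _ _).
  by eexists.
rewrite -kE comp_pair compBl -!compA pr1_pair pr2_pair compm0 subr0 !compDr !compA IHn.
rewrite one_minus_thread thread_last !comp1m comp0m addr0 kE compA.
by apply: pair_ext; rewrite !bpE // [LHS]addrC subrK.
Qed.

Lemma thread_kernel n : is_kernel (thread n) (one_minus n).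
Proof.
apply: kernelI.
- exact: one_minus_thread.
- by move=> W a b /(congr1 (comp (bpr2 _ _))); rewrite !compA thread_last !comp1m.
elim: n => [|n IHn] W h.
  move=> _; exists (bpr2 _ _ ∘ h); apply: pair_ext; first exact: psum0_zero.
  by rewrite !compA (thread_last 0) comp1m.
have -> : one_minus n.+1 = pair (one_minus n ∘ bpr1 _ _)
  (bpr2 _ _ ∘ bpr1 _ _ - t n ∘ bpr2 _ _) by [].
move=> e; have := congr1 (comp (bpr1 _ _)) e; rewrite !bpE -compA => /IHn [k tk].
have := congr1 (comp (bpr2 _ _)) e; rewrite !bpE -(compA (bpr2 _ (X n))) -tk (compA _
  (thread n)) thread_last comp1m.
move=> /eqP; rewrite subr_eq0 => /eqP kE.
exists (bpr2 _ _ ∘ h); apply: pair_ext; last first.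
  by rewrite (compA (bpr2 _ _)) (thread_last n.+1) comp1m.
by rewrite (compA (bpr1 _ _)) thread_init -compA (compA (t n)) -kE.
Qed.

End OneMinusTransition.
End PartialSums.

Section Coelementary.
Variable E : exact_category.
Hypothesis wic : weakly_idempotent_complete E.
Hypothesis coel : weakly_omega_coelementary E.

Lemma psum_adm_epi (X : nat -> E) : adm_epi_tower (psum_tower X).
Proof. by move=> n; apply: ses_adm_epi (ses_bin2 _ _). Qed.

Lemma product_exists (X : nat -> E) :
  exists (P : E) (p : forall n, Hom P (X n)), is_product p.
Proof.
have [P [q lq]] := coel.1 _ (psum_adm_epi X).
by exists P; eexists; apply: psum_limit_product lq.
Qed.

Lemma ses_product (X Y Z : nat -> E) (f : forall n, Hom (X n) (Y n))
    (g : forall n, Hom (Y n) (Z n)) (PX PY PZ : E) (pX : forall n, Hom PX (X n))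
    (pY : forall n, Hom PY (Y n)) (pZ : forall n, Hom PZ (Z n))
    (F : Hom PX PY) (G : Hom PY PZ) :
  (forall n, ses (f n) (g n)) ->
  is_product pX -> is_product pY -> is_product pZ ->
  (forall n, pY n ∘ F = f n ∘ pX n) -> (forall n, pZ n ∘ G = g n ∘ pY n) -> ses F G.
Proof.
move=> sfg hX hY hZ hF hG.
have nat_map (A B : nat -> E) (h : forall n, Hom (A n) (B n)) n :
    tmap (psum_tower B) n ∘ psum_map h n.+1 = psum_map h n ∘ tmap (psum_tower A) n.
  by rewrite /= tri_pr1.
have lift_map (A B : nat -> E) (h : forall n, Hom (A n) (B n)) (PA PB : E)
    (pA : forall n, Hom PA (A n)) (pB : forall n, Hom PB (B n)) (H : Hom PA PB) :
    (forall n, pB n ∘ H = h n ∘ pA n) ->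
    forall n, psum_lift pB n ∘ H = psum_map h n ∘ psum_lift pA n.
  move=> hH; elim=> [|n IHn] /=; first by rewrite comp0m compm0.
  by rewrite comp_pair tri_pair IHn hH comp0m add0r.
apply: (coel.2 _ _ _ 
  (@TowerMap _ (psum_tower X) (psum_tower Y) (psum_map f) (nat_map _ _ f))
  (@TowerMap _ (psum_tower Y) (psum_tower Z) (psum_map g) (nat_map _ _ g))
  (psum_adm_epi X) (psum_adm_epi Y) (psum_adm_epi Z) _ _ _ _ _ _ _
  (product_psum_limit hX) (product_psum_limit hY) (product_psum_limit hZ)).
- elim=> [|n IHn] /=; last exact: ses_tri.
  apply: split_exact_ses; exists (idm _), (idm _).
  by rewrite !comp1m; split=> //; apply: psum0_zero.
- exact: lift_map.
- exact: lift_map.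
Qed.

Section OneMinus.
Variables (X : nat -> E) (t : forall n, Hom (X n.+1) (X n)).
Variables (P : E) (p : forall n, Hom P (X n)) (u : Hom P P).
Hypothesis pP : is_product p.
Hypothesis pu : forall n, p n ∘ u = p n - t n ∘ p n.+1.

(** A Mittag-Leffler argument: the split sequences [X n -> psum X n.+1 -> psum X n] given by
    [thread] and [one_minus] form a short exact sequence of towers with admissible transition maps,
    whose limit is [L -> P -> P] with second map [u]. *)
Lemma one_minus_adm_epi : (forall n, adm_epi (t n)) -> adm_epi u.
Proof.
move=> et; have [L [l [cl ll]]] := coel.1 (Tower t) et.
have lu n : psum_lift p n ∘ u = one_minus t n ∘ psum_lift p n.+1.
  elim: n => [|n IHn]; first exact: psum0_zero.
  rewrite [LHS]/= comp_pair IHn pu.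
  by apply: pair_ext; rewrite /= !bpE ?addE.
have [f lf] := product_lift pP l.
apply: (ses_adm_epi (i := f)).
have nat_thread n : bpr1 (psum X n.+1) (X n.+1) ∘ thread t n.+1 = thread t n ∘ t n.
  exact: thread_init.
have nat_one_minus n : bpr1 (psum X n) (X n) ∘ one_minus t n.+1 =
    one_minus t n ∘ bpr1 (psum X n.+1) (X n.+1).
  by rewrite /= pr1_pair.
pose V : tower E := @Tower E (fun n => psum X n.+1) (fun n => bpr1 (psum X n.+1) (X
  n.+1)).
have limS := product_psum_limit pP.
have limV : is_tower_limit (X := V) (fun n => psum_lift p n.+1).
  split=> [n|W w cw]; first exact: (limS.1 n.+1).
  (* A cone on [V] extends to one on [psum_tower X] by the zero map into the zero object
     [psum X 0]. *)
  pose w' n : Hom W (psum X n) := if n is m.+1 then w m else 0.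
  have [|v [wv uv]] := limS.2 W w'.
    by case=> [|n]; [apply: psum0_zero | apply: cw].
  exists v; split=> [n|v' wv']; first exact: (wv n.+1).
  by apply: uv => -[|n]; [apply: psum0_zero | apply: wv'].
apply: (coel.2 (Tower t) V (psum_tower X)
  (@TowerMap _ (Tower t) V (thread t) nat_thread)
  (@TowerMap _ V (psum_tower X) (one_minus t) nat_one_minus)
  et _ (psum_adm_epi X) _ _ _ _ _ _ _ (conj cl ll) limV limS).
- by move=> n; apply: (@psum_adm_epi X n.+1).
- move=> n; apply: ses_of_kernel; last exact: thread_kernel.
  exact/(adm_epi_split wic)/one_minusK.
- elim=> [|n IHn].
    apply: pair_ext; first exact: psum0_zero.
    by rewrite /= !bpE lf.
  apply: pair_ext; rewrite /= !bpE ?lf //.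
  by rewrite -(compA (thread t n)) (cl n) -IHn /= comp_pair.
- exact: lu.
Qed.

End OneMinus.

Lemma one_minus_adm_epi_eventually (X : nat -> E) (t : forall n, Hom (X n.+1) (X n))
    (P : E) (p : forall n, Hom P (X n)) (u : Hom P P) N :
  is_product p -> (forall n, p n ∘ u = p n - t n ∘ p n.+1) ->
  (forall n, (N <= n)%N -> adm_epi (t n)) -> adm_epi u.
Proof.
elim: N X t P p u => [|N IHN] X t P p u pP pu et.
  by apply: (one_minus_adm_epi pP pu) => n; apply: et.
have [P' [p' pP']] := product_exists (fun n => X n.+1).
have [u' pu'] := product_lift pP' (fun n => p' n - t n.+1 ∘ p' n.+1).
have eu' : adm_epi u'.
  by apply: (IHN _ (fun n => t n.+1) _ _ _ pP' pu') => n le; apply: et.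
have [pi pip] := product_lift pP' (fun n => p n.+1).
have [W [c [v [ec uv]]]] := pullback_cover pi eu'.
pose w n : Hom W (X n) := if n is m.+1 then p' m ∘ v else p 0 ∘ c + t 0 ∘ (p' 0 ∘ v).
have [v' pv'] := product_lift pP w.
apply: (adm_epi_of_local wic (v := v') ec); apply: (product_ext pP) => n.
rewrite compA pu compBl -compA !pv'; case: n => [|n] /=; first by rewrite addrK.
by have := congr1 (comp (p' n)) uv; rewrite !compA pu' pip compBl => <-.
Qed.

End Coelementary.

(** * Homotopy limits of towers *)

Section TowersOfComplexes.
Variable A : add_category.

Record product_complex (Y : nat -> complex A) := ProductComplex {
  pob :> complex A;
  ppr : forall n, chain_map pob (Y n);
  pprP : forall k, is_product (fun n => ppr n k) }.

Lemma product_chain_lift (Y : nat -> complex A) (P : product_complex Y) (W : complex A)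
    (w : forall n, chain_map W (Y n)) :
  {g : chain_map W P | forall n k, ppr P n k ∘ g k = w n k}.
Proof.
apply: cid.
have /dep_choice [g gw] : forall k, exists g : Hom (W k) (P k),
    forall n, ppr P n k ∘ g = w n k by move=> k;
      exact: (product_lift (@pprP _ P k) (fun n => w n k)).
have gd k : cd P k ∘ g k = g (k - 1) ∘ cd W k.
  apply: (product_ext (@pprP _ P _)) => n.
  by rewrite compA -cmd -compA gw cmd compA gw.
by exists (ChainMap gd).
Qed.

Section OneMinusShift.
Variables (Y : nat -> complex A) (t : forall n, chain_map (Y n.+1) (Y n)).
Variable P : product_complex Y.

Lemma one_minus_shift_cmd n k :
  cd (Y n) k ∘ (ppr P n k - t n k ∘ ppr P n.+1 k) =
  (ppr P n (k - 1) - t n (k - 1) ∘ ppr P n.+1 (k - 1)) ∘ cd P k.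
Proof. by rewrite compBr compBl compA !cmd -!compA cmd. Qed.

Definition one_minus_shift : chain_map P P :=
  sval (product_chain_lift P (fun n => ChainMap (one_minus_shift_cmd n))).

Lemma ppr_one_minus_shift n k :
  ppr P n k ∘ one_minus_shift k = ppr P n k - t n k ∘ ppr P n.+1 k.
Proof. exact: (svalP (product_chain_lift P (fun n => ChainMap (one_minus_shift_cmd
  n)))). Qed.

(* A model of the suspension of the homotopy limit of the tower. *)
Definition hocone : complex A := cone one_minus_shift.

Definition is_chain_cone (L : complex A) (l : forall n, chain_map L (Y n)) : Prop :=
  forall n k, t n k ∘ l n.+1 k = l n k.

Definition tuple_map (L : complex A) (l : forall n,
  chain_map L (Y n)) : chain_map L P :=
  sval (product_chain_lift P l).

Lemma ppr_tuple_map L (l : forall n, chain_map L (Y n)) n k :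
  ppr P n k ∘ tuple_map l k = l n k.
Proof. exact: (svalP (product_chain_lift P l)). Qed.

Lemma one_minus_tuple L (l : forall n, chain_map L (Y n)) :
  is_chain_cone l -> forall k, one_minus_shift k ∘ tuple_map l k = 0.
Proof.
move=> cl k; apply: (product_ext (@pprP _ P _)) => n.
by rewrite compA ppr_one_minus_shift compBl -compA !ppr_tuple_map cl subrr compm0.
Qed.

Definition to_hocone L (l : forall n, chain_map L (Y n)) (cl : is_chain_cone l) :
  chain_map (shift L) hocone :=
  @to_cone A L P P (tuple_map l) one_minus_shift (one_minus_tuple cl).

End OneMinusShift.

Section HoconeMap.
Variables (Y Y' : nat -> complex A) (t : forall n, chain_map (Y n.+1) (Y n))
  (t' : forall n, chain_map (Y' n.+1) (Y' n)).
Variables (P : product_complex Y) (P' : product_complex Y').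
Variables (f : forall n, chain_map (Y n) (Y' n)).

Definition is_tower_chain_map : Prop :=
  forall n k, t' n k ∘ f n.+1 k = f n k ∘ t n k.

Definition product_map : chain_map P P' :=
  tuple_map P' (fun n => ch_comp (f n) (ppr P n)).

Lemma ppr_product_map n k : ppr P' n k ∘ product_map k = f n k ∘ ppr P n k.
Proof. exact: ppr_tuple_map. Qed.

Hypothesis ft : is_tower_chain_map.

Lemma product_map_one_minus k :
  product_map k ∘ one_minus_shift t P k = one_minus_shift t' P' k ∘ product_map k.
Proof.
apply: (product_ext (@pprP _ P' _)) => n.
rewrite !compA ppr_product_map ppr_one_minus_shift -compA ppr_one_minus_shift.
by rewrite compBr compBl -!compA !ppr_product_map !compA ft.
Qed.

Definition hocone_map : chain_map (hocone t P) (hocone t' P') :=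
  @cone_map A P P P' P' (one_minus_shift t P) (one_minus_shift t' P')
    product_map product_map product_map_one_minus.

Lemma hocone_map_natural L L' (l : forall n, chain_map L (Y n))
    (l' : forall n, chain_map L' (Y' n)) (cl : is_chain_cone t l)
    (cl' : is_chain_cone t' l') (g : chain_map L L') :
  (forall n k, f n k ∘ l n k = l' n k ∘ g k) ->
  forall k, hocone_map k ∘ to_hocone P cl k = to_hocone P' cl' k ∘ shift_map g k.
Proof.
move=> flg k /=; apply: pair_ext; rewrite !bpE ?addr0 //.
apply: (product_ext (@pprP _ P' _)) => n.
by rewrite !compA ppr_product_map ppr_tuple_map -compA ppr_tuple_map flg.
Qed.

End HoconeMap.

Section KernelComplex.
Variables (P Q : complex A) (u : chain_map P Q).

Lemma kernel_complex : (forall k, exists (K : A) (i : Hom K (P k)),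
  is_kernel i (u k)) ->
  exists (K : complex A) (i : chain_map K P), forall k, is_kernel (i k) (u k).
Proof.
move=> /dep_choice [K /dep_choice [i ker]].
have /dep_choice [d id] : forall k, exists d, i (k - 1) ∘ d = cd P k ∘ i k.
  by move=> k; apply: (kernel_lift (ker _)); rewrite compA -cmd -compA (ker k).1 compm0.
have ddK k : d (k - 1) ∘ d k = 0.
  apply: (mono_eq0 (kernel_mono (ker _))).
  by rewrite compA id -compA id compA cdd comp0m.
by exists (Complex ddK), (@ChainMap A (Complex ddK) P i (fun k => esym (id k))).
Qed.

Lemma kernel_complex_lift (K W : complex A) (i : chain_map K P) (w : chain_map W P) :
  (forall k, is_kernel (i k) (u k)) -> (forall k, u k ∘ w k = 0) ->
  exists g : chain_map W K, forall k, i k ∘ g k = w k.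
Proof.
move=> ker uw.
have /dep_choice [g ig] : forall k, exists g, i k ∘ g = w k.
  by move=> k; apply: (kernel_lift (ker k)).
have gd k : cd K k ∘ g k = g (k - 1) ∘ cd W k.
  apply: (kernel_mono (ker _)).
  by rewrite compA -cmd -compA ig cmd compA ig.
by exists (ChainMap gd).
Qed.

End KernelComplex.

Section ChainLimit.
Variables (Y : nat -> complex A) (t : forall n, chain_map (Y n.+1) (Y n)).
Variable P : product_complex Y.
Local Notation u := (one_minus_shift t P).

Lemma kernel_is_limit (K : complex A) (i : chain_map K P) :
  (forall k, is_kernel (i k) (u k)) ->
  is_tower_limit (C := Ch A) (X := @Tower (Ch A) Y t) (fun n => ch_comp (ppr P n) i).
Proof.
move=> ker; split=> [n|W w cw].
  apply: chain_map_eq => k /=; apply/eqP; rewrite eq_sym -subr_eq0; apply/eqP.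
  by rewrite compA -compBl -ppr_one_minus_shift -compA (ker k).1 compm0.
have cw' : is_chain_cone t w.
  by move=> n k; have /(congr1 (fun z : chain_map _ _ => z k)) := cw n.
have [g ig] := kernel_complex_lift ker (one_minus_tuple P cw').
exists g; split=> [n|g' gw].
  by apply: chain_map_eq => k /=; rewrite -compA ig ppr_tuple_map.
apply: chain_map_eq => k; apply: (kernel_mono (ker k)).
apply: (product_ext (@pprP _ P _)) => n.
rewrite ig ppr_tuple_map compA.
by have /(congr1 (fun z : chain_map _ _ => z k)) := gw n.
Qed.

Lemma chain_limit_lift (L : complex A) (l : forall n, chain_map L (Y n)) (W : complex A)
    (w : forall n, chain_map W (Y n)) :
  is_tower_limit (C := Ch A) (X := @Tower (Ch A) Y t) l -> is_chain_cone t w ->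
  exists g : chain_map W L, forall n k, l n k ∘ g k = w n k.
Proof.
move=> [_ lim] cw; have [|g [lg _]] := lim W w.
  by move=> n; apply: chain_map_eq => k; apply: cw.
by exists g => n k; have /(congr1 (fun z : chain_map _ _ => z k)) := lg n.
Qed.

Lemma chain_limit_ext (L : complex A) (l : forall n, chain_map L (Y n)) (W : complex A)
    (a b : chain_map W L) :
  is_tower_limit (C := Ch A) (X := @Tower (Ch A) Y t) l ->
  (forall n k, l n k ∘ a k = l n k ∘ b k) -> a = b.
Proof.
move=> [cl lim] ab.
have [|g [_ ug]] := lim W (fun n => ch_comp (l n) b).
  move=> n; have e := cl n; apply: chain_map_eq => k /=.
  by have /(congr1 (fun z : chain_map _ _ => z k)) <- := e; rewrite /= compA.
rewrite -(ug a) ?(ug b) // => n; exact: chain_map_eq.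
Qed.

(** A limit in [Ch] is not degreewise by definition. Once degreewise kernels exist they form a
    second limit [K], and comparing [L] with [K] in both directions transfers the kernel
    property. *)
Lemma limit_is_kernel (L : complex A) (l : forall n, chain_map L (Y n)) :
  (forall k, exists (K : A) (i : Hom K (P k)), is_kernel i (u k)) ->
  is_tower_limit (C := Ch A) (X := @Tower (Ch A) Y t) l ->
  is_chain_cone t l /\ forall k, is_kernel (tuple_map P l k) (u k).
Proof.
move=> /kernel_complex [K [i ker]] [cl ll].
have cl' : is_chain_cone t l.
  by move=> n k; have /(congr1 (fun z : chain_map _ _ => z k)) := cl n.
split=> //; have [g ig] := kernel_complex_lift ker (one_minus_tuple P cl').
have [cK _] := kernel_is_limit ker.
have [h [lh _]] := ll _ _ cK.
have lh' n k : l n k ∘ h k = ppr P n k ∘ i k.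
  by have /(congr1 (fun z : chain_map _ _ => z k)) := lh n.
have lig n k : ppr P n k ∘ i k ∘ g k = l n k by rewrite -compA ig ppr_tuple_map.
have hg k : h k ∘ g k = idm (L k).
  have [x [_ ux]] := ll _ _ cl.
  have e1 : x = ch_comp h g.
    by apply: ux => n; apply: chain_map_eq => j /=; rewrite compA lh' lig.
  have e2 : x = ch_id L.
    by apply: ux => n; apply: chain_map_eq => j /=; rewrite compm1.
  by have := congr1 (fun z : chain_map _ _ => z k) (etrans (esym e1) e2).
move=> k; apply: kernelI.
- exact: one_minus_tuple.
- apply: mono_of_eq0 => W a; rewrite -ig -compA => /(mono_eq0 (kernel_mono (ker k))).
  by move=> ga; rewrite -[a]comp1m -hg -compA ga compm0.
- move=> W w /(kernel_lift (ker k)) [v iv]; exists (h k ∘ v).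
  rewrite -iv compA; congr (_ ∘ _); apply: (product_ext (@pprP _ P _)) => n.
  by rewrite compA ppr_tuple_map lh'.
Qed.

End ChainLimit.

Lemma kernel_split_exact (X Y Z : A) (i : Hom X Y) (p : Hom Y Z) (s : Hom Z Y) :
  is_kernel i p -> p ∘ s = idm Z -> split_exact i p.
Proof.
move=> ker ps; have im := kernel_mono ker.
have [r ir] : exists r, i ∘ r = idm Y - s ∘ p.
  by apply: (kernel_lift ker); rewrite compBr compA ps comp1m compm1 subrr.
exists r, s; split=> //.
- by apply: im; rewrite compA ir compBl comp1m -compA ker.1 compm0 subr0 compm1.
- exact: ker.1.
- by apply: (mono_eq0 im); rewrite compA ir compBl comp1m -compA ps compm1 subrr.
- by rewrite ir subrK.
Qed.

(* With sections of the transition maps, [x_i - t x_(i+1) = y_i] is solved by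
   [x_0 = 0] and [x_(i+1) = s (x_i - y_i)]. *)
Lemma one_minus_split (X : nat -> A) (t : forall n, Hom (X n.+1) (X n))
    (s : forall n, Hom (X n) (X n.+1)) (P : A) (p : forall n, Hom P (X n))
    (u : Hom P P) :
  is_product p -> (forall n, p n ∘ u = p n - t n ∘ p n.+1) ->
  (forall n, t n ∘ s n = idm (X n)) -> exists sigma, u ∘ sigma = idm P.
Proof.
move=> pP pu ts.
pose x := fix x n : Hom P (X n) := if n is m.+1 then s m ∘ (x m - p m) else 0.
have [sigma ps] := product_lift pP x; exists sigma.
apply: (product_ext pP) => n.
rewrite compA pu compBl -compA !ps /= compA ts comp1m compm1.
by rewrite opprB addrCA subrr addr0.
Qed.

End TowersOfComplexes.

Section HomotopyLimits.
Variable E : exact_category.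
Hypothesis wic : weakly_idempotent_complete E.
Hypothesis coel : weakly_omega_coelementary E.

Lemma product_complex_exists (Y : nat -> complex E) : inhabited (product_complex Y).
Proof.
have /dep_choice [P /dep_choice [p pP]] : forall k, exists (P : E)
    (p : forall n, Hom P (Y n k)), is_product p.
  by move=> k; apply: product_exists.
have /dep_choice [d pd] : forall k, exists d : Hom (P k) (P (k - 1)),
    forall n, p (k - 1) n ∘ d = cd (Y n) k ∘ p k n.
  by move=> k; apply: (product_lift (pP _)).
have ddP k : d (k - 1) ∘ d k = 0.
  apply: (product_ext (pP _)) => n.
  by rewrite compA pd -compA pd compA cdd comp0m compm0.
have pdn n k : cd (Y n) k ∘ p k n = p (k - 1) n ∘ d k by rewrite pd.
constructor; apply: (@ProductComplex _ Y (Complex ddP)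
  (fun n => @ChainMap _ (Complex ddP) (Y n) (fun k => p k n) (pdn n))) => k.
exact: pP.
Qed.

Lemma acyclic_product (Y : nat -> complex E) (P : product_complex Y) :
  (forall n, acyclic (Y n)) -> acyclic P.
Proof.
move=> /dep_choice [Z /dep_choice [i /dep_choice [p H]]].
have /dep_choice [PZ /dep_choice [z zP]] : forall k, exists (PZ : E)
    (z : forall n, Hom PZ (Z n k)), is_product z.
  by move=> k; apply: product_exists.
have /dep_choice [Pi iE] : forall k, exists Pi : Hom (PZ k) (P k),
    forall n, ppr P n k ∘ Pi = i n k ∘ z k n.
  by move=> k; apply: (product_lift (@pprP _ _ P k)).
have /dep_choice [Pp pE] : forall k, exists Pp : Hom (P k) (PZ (k - 1)),
    forall n, z (k - 1) n ∘ Pp = p n k ∘ ppr P n k.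
  by move=> k; apply: (product_lift (zP (k - 1))).
exists PZ, Pi, Pp => k; split.
  apply: (ses_product wic coel _ (zP k) (@pprP _ _ P k) (zP (k - 1)) (iE k) (pE k)).
  by move=> n; case: (H n k).
apply: (product_ext (@pprP _ _ P _)) => n.
by rewrite compA iE -compA pE -cmd (H n k).2 compA.
Qed.

(** In each degree a cone is a biproduct, so the cone of a product of maps is the product of the
    cones. *)
Lemma weak_equiv_product (Y Y' : nat -> complex E) (P : product_complex Y)
    (P' : product_complex Y') (f : forall n, chain_map (Y n) (Y' n)) :
  (forall n, weak_equiv (f n)) -> weak_equiv (product_map P P' f).
Proof.
move=> wf.
have sq n k : ppr P' n k ∘ product_map P P' f k = f n k ∘ ppr P n k.
  exact: ppr_product_map.
have CP k : is_product (fun n => cone_map (sq n) k).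
  apply: productI => [W w|W a b ab] /=.
    have [x px] := product_lift (@pprP _ _ P (k - 1)) (fun n => bpr1 _ _ ∘ w n).
    have [y py] := product_lift (@pprP _ _ P' k) (fun n => bpr2 _ _ ∘ w n).
    exists (pair x y) => n; rewrite tri_pair px py comp0m add0r.
    exact: pair_eta.
  apply: pair_ext.
    apply: (product_ext (@pprP _ _ P _)) => n.
    by have /(congr1 (comp (bpr1 _ _))) := ab n; rewrite /= !bpE.
  apply: (product_ext (@pprP _ _ P' _)) => n.
  by have /(congr1 (comp (bpr2 _ _))) := ab n; rewrite /= !bpE ?addE.
exact: (acyclic_product (ProductComplex CP)).
Qed.

Section Equivalences.
Variables (Y Y' : nat -> complex E) (t : forall n, chain_map (Y n.+1) (Y n))
  (t' : forall n, chain_map (Y' n.+1) (Y' n)).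

Definition is_hlim L (l : forall n, chain_map L (Y n)) : Prop :=
  exists (P : product_complex Y) (cl : is_chain_cone t l), weak_equiv (to_hocone P cl).

End Equivalences.

(** Required for all choices of products, so that it applies to the one that [is_hlim] provides
    existentially. *)
Definition hlim_equiv (Y Y' : nat -> complex E) (t : forall n, chain_map (Y n.+1) (Y n))
    (t' : forall n, chain_map (Y' n.+1) (Y' n)) (f : forall n,
      chain_map (Y n) (Y' n)) :=
  exists ft : is_tower_chain_map t t' f,
  forall (P : product_complex Y) (P' : product_complex Y'),
    weak_equiv (hocone_map P P' ft).

Section Comparison.
Variables (Y Y' : nat -> complex E) (t : forall n, chain_map (Y n.+1) (Y n))
  (t' : forall n, chain_map (Y' n.+1) (Y' n)) (f : forall n, chain_map (Y n) (Y' n)).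

Lemma hlim_equiv_levelwise : is_tower_chain_map t t' f ->
  (forall n, weak_equiv (f n)) -> hlim_equiv t t' f.
Proof.
move=> ft wf; exists ft => P P'.
by apply: weak_equiv_cone_map => //; apply: weak_equiv_product.
Qed.

(** On the products, [sigma] with its index shift turns [1 - t] and [1 - t'] into [1 - sigma f] and
    [1 - f sigma], the situation of [weak_equiv_interleaved]. The maps [f n] themselves need not be
    weak equivalences. *)
Lemma hlim_equiv_interleaved (sigma : forall n, chain_map (Y' n.+1) (Y n)) :
  is_tower_chain_map t t' f ->
  (forall n k, f n k ∘ sigma n k = t' n k) ->
  (forall n k, sigma n k ∘ f n.+1 k = t n k) -> hlim_equiv t t' f.
Proof.
move=> ft fs sf; exists ft => P P'.
apply: (weak_equiv_interleaved wic
  (sigma := tuple_map P (fun n => ch_comp (sigma n) (ppr P' n.+1)))) => k.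
  apply: (product_ext (@pprP _ _ P _)) => n.
  rewrite ppr_one_minus_shift compBr compm1 compA ppr_tuple_map /= -compA.
  by rewrite ppr_product_map compA sf.
apply: (product_ext (@pprP _ _ P' _)) => n.
rewrite ppr_one_minus_shift compBr compm1 compA ppr_product_map -compA.
by rewrite ppr_tuple_map /= compA fs.
Qed.

Variables (L L' : complex E) (l : forall n, chain_map L (Y n))
  (l' : forall n, chain_map L' (Y' n)) (g : chain_map L L').
Hypothesis fe : hlim_equiv t t' f.
Hypothesis flg : forall n k, f n k ∘ l n k = l' n k ∘ g k.

Lemma hlim_compare : is_hlim t l -> is_hlim t' l' -> weak_equiv g.
Proof.
have [ft wf] := fe => -[P [cl wl]] [P' [cl' wl']].
have sq := @hocone_map_natural _ _ _ _ _ P P' _ ft _ _ _ _ cl cl' g flg.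
apply: (weak_equiv_unshift wic); apply: (weak_equiv_cancel_target wic
  (h := ch_comp (hocone_map P P' ft) (to_hocone P cl)) _ wl').
  by move=> k; apply/esym/sq.
by apply: (weak_equiv_comp wic _ wl (wf P P')).
Qed.

Lemma hlim_source : is_chain_cone t l -> is_hlim t' l' -> weak_equiv g -> is_hlim t l.
Proof.
have [ft wf] := fe => cl [P' [cl' wl']] wg; have [P] := product_complex_exists Y.
have sq := @hocone_map_natural _ _ _ _ _ P P' _ ft _ _ _ _ cl cl' g flg.
exists P, cl; apply: (weak_equiv_cancel_target wic
  (h := ch_comp (to_hocone P' cl') (shift_map g)) sq (wf P P')).
by apply: (weak_equiv_comp wic _ (weak_equiv_shift wic wg) wl').
Qed.

Lemma hlim_target : is_chain_cone t' l' -> is_hlim t l -> weak_equiv g -> is_hlim t' l'.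
Proof.
have [ft wf] := fe => cl' [P [cl wl]] wg; have [P'] := product_complex_exists Y'.
have sq := @hocone_map_natural _ _ _ _ _ P P' _ ft _ _ _ _ cl cl' g flg.
exists P', cl'; apply: (weak_equiv_cancel_source wic
  (h := ch_comp (hocone_map P P' ft) (to_hocone P cl)) _ (weak_equiv_shift wic wg)).
  by move=> k; apply/esym/sq.
by apply: (weak_equiv_comp wic _ wl (wf P P')).
Qed.

End Comparison.

Lemma hlim_of_ses (Y : nat -> complex E) (t : forall n, chain_map (Y n.+1) (Y n))
    (P : product_complex Y) L (l : forall n, chain_map L (Y n)) :
  is_chain_cone t l ->
  (forall k, ses (tuple_map P l k) (one_minus_shift t P k)) -> is_hlim t l.
Proof. by move=> cl s; exists P, cl; apply: weak_equiv_to_cone. Qed.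

(** The bound [N] may vary with the degree, as it does for truncations, where the map at stage [n]
    is controlled only below degree [n]. *)
Lemma hlim_of_limit (Y : nat -> complex E) (t : forall n, chain_map (Y n.+1) (Y n))
    L (l : forall n, chain_map L (Y n)) :
  (forall k, exists N, forall n, (N <= n)%N -> adm_epi (t n k)) ->
  is_tower_limit (C := Ch E) (X := @Tower (Ch E) Y t) l -> is_hlim t l.
Proof.
move=> et lim; have [P] := product_complex_exists Y.
have eu k : adm_epi (one_minus_shift t P k).
  have [N eN] := et k.
  apply: (one_minus_adm_epi_eventually wic coel (@pprP _ _ P k) _ eN) => n.
  exact: ppr_one_minus_shift.
have [|cl ker] := limit_is_kernel (P := P) _ lim.
  by move=> k; have [K [i /ses_kernel s]] := eu k; exists K, i.
by apply: (hlim_of_ses (P := P) cl) => k; apply: ses_of_kernel.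
Qed.

End HomotopyLimits.

(** * Towers with degreewise split transition maps *)

Section ReindexingLemmas.
Variable A : add_category.

Lemma xcast_erefl (X : int -> A) m (e : m = m) : xcast X e = idm (X m).
Proof. by rewrite (eq_irrelevance e erefl). Qed.

Lemma xcastK (X : int -> A) m n (e : m = n) (e' : n = m) :
  xcast X e' ∘ xcast X e = idm (X m).
Proof. by subst n; rewrite !xcast_erefl comp1m. Qed.

Lemma cm_xcast (X Y : complex A) (f : chain_map X Y) m n (e : m = n) :
  f n ∘ xcast X e = xcast Y e ∘ f m.
Proof. by subst n; rewrite !xcast_erefl comp1m compm1. Qed.

Lemma dd_dd (X : complex A) m n k (e : n = m - 1) (e' : k = n - 1) :
  dd X e' ∘ dd X e = 0.
Proof. by subst k; rewrite dd_erefl cd_dd. Qed.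

Lemma xcast_dd (X : complex A) m n n' (c : n = n') (e : n = m - 1) (e' : n' = m - 1) :
  xcast X c ∘ dd X e = dd X e'.
Proof. by subst n'; rewrite xcast_erefl comp1m (eq_irrelevance e e'). Qed.

Lemma dd_xcast (X : complex A) m m' n (c : m = m') (e : n = m - 1) (e' : n = m' - 1) :
  dd X e' ∘ xcast X c = dd X e.
Proof. by subst m'; rewrite xcast_erefl compm1 (eq_irrelevance e e'). Qed.

End ReindexingLemmas.

Section PathComplex.
Variable A : add_category.

Lemma predK (n : int) : n = n - 1 + 1.
Proof. by rewrite subrK. Qed.

Lemma pred_succ (n : int) : n - 1 + 1 = n + 1 - 1.
Proof. by rewrite subrK addrK. Qed.

Lemma succK (n : int) : n = n + 1 - 1.
Proof. by rewrite addrK. Qed.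

Section Object.
Variable X : complex A.

Definition path_proj n : Hom (biprod (X n) (X (n + 1))) (X (n - 1 + 1)) :=
  xcast X (predK n) ∘ bpr1 _ _ - dd X (pred_succ n) ∘ bpr2 _ _.

Definition path_d n :
    Hom (biprod (X n) (X (n + 1))) (biprod (X (n - 1)) (X (n - 1 + 1))) :=
  pair (cd X n ∘ bpr1 _ _) (path_proj n).

Lemma path_dd n : path_d (n - 1) ∘ path_d n = 0.
Proof.
rewrite /path_d comp_pair /path_proj; apply: pair_ext; rewrite !bpE.
  by rewrite cdd comp0m.
rewrite dd_dd comp0m subr0 -dd_erefl (xcast_dd _ _ _ (esym (predK (n - 1)))).
by rewrite (dd_xcast _ (predK n) (esym (predK (n - 1)))) subrr.
Qed.

(* The path complex [(x, y) |-> (d x, x - d y)], a contractible complex onto [X]. *)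
Definition path_complex : complex A :=
  @Complex A (fun n => biprod (X n) (X (n + 1))) path_d path_dd.

Lemma path_out_cmd n : cd X n ∘ bpr1 (X n) (X (n + 1)) =
  bpr1 (X (n - 1)) (X (n - 1 + 1)) ∘ cd path_complex n.
Proof. by rewrite /= pr1_pair. Qed.

Definition path_out : chain_map path_complex X :=
  @ChainMap A path_complex X (fun n => bpr1 _ _) path_out_cmd.

(** The cycles in degree [n] are the pairs [(d y, y)], a copy of [X (n + 1)]. *)
Lemma path_split_acyclic : split_acyclic path_complex.
Proof.
exists (fun n => X (n + 1)), (fun n => pair (dd X (succK n)) (idm _)), path_proj.
move=> n; split.
  exists (bpr2 _ _), (bin1 _ _ ∘ xcast X (esym (predK n))).
  split; rewrite /path_proj ?bpE //.
  - by rewrite xcastK oppr0 addr0.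
  - by rewrite (xcast_dd _ _ _ (pred_succ n)) subrr.
  - rewrite /=; apply: pair_ext; rewrite !bpE ?subr0 ?addr0 //.
    by rewrite xcastK comp1m (xcast_dd _ _ _ (succK n)) [LHS]addrC subrK.
rewrite /= /path_d /path_proj; apply: pair_ext; rewrite !bpE //.
rewrite dd_dd comp0m subr0.
by rewrite (dd_xcast _ (predK n) (erefl (n - 1))) dd_erefl.
Qed.

End Object.

Lemma path_map_cmd (X Y : complex A) (f : chain_map X Y) n :
  cd (path_complex Y) n ∘ tri (f n) 0 (f (n + 1)) =
  tri (f (n - 1)) 0 (f (n - 1 + 1)) ∘ cd (path_complex X) n.
Proof.
apply: pair_ext; rewrite /= /path_d /path_proj !bpE ?cmd //.
by rewrite !add0r cm_xcast cm_dd.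
Qed.

Definition path_map (X Y : complex A) (f : chain_map X Y) :
  chain_map (path_complex X) (path_complex Y) :=
  @ChainMap A (path_complex X) (path_complex Y) (fun n => tri (f n) 0 (f (n + 1)))
    (path_map_cmd f).

Lemma chain_biprod_dd (X Y : complex A) n :
  tri (cd X (n - 1)) 0 (cd Y (n - 1)) ∘ tri (cd X n) 0 (cd Y n) = 0.
Proof. by rewrite tri_comp !cdd compm0 comp0m addr0 tri0. Qed.

Definition chain_biprod (X Y : complex A) : complex A :=
  @Complex A (fun n => biprod (X n) (Y n)) (fun n => tri (cd X n) 0 (cd Y n))
    (chain_biprod_dd X Y).

Lemma chain_bin1_cmd (X Y : complex A) n :
  cd (chain_biprod X Y) n ∘ bin1 (X n) (Y n) = bin1 (X (n - 1)) (Y (n - 1)) ∘ cd X n.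
Proof. by apply: pair_ext; rewrite /= !bpE ?addr0. Qed.

Definition chain_bin1 (X Y : complex A) : chain_map X (chain_biprod X Y) :=
  @ChainMap A X (chain_biprod X Y) (fun n => bin1 _ _) (@chain_bin1_cmd X Y).

Lemma chain_bpr2_cmd (X Y : complex A) n :
  cd Y n ∘ bpr2 (X n) (Y n) = bpr2 (X (n - 1)) (Y (n - 1)) ∘ cd (chain_biprod X Y) n.
Proof. by rewrite /= !bpE add0r. Qed.

Definition chain_bpr2 (X Y : complex A) : chain_map (chain_biprod X Y) Y :=
  @ChainMap A (chain_biprod X Y) Y (fun n => bpr2 _ _) (@chain_bpr2_cmd X Y).

Lemma split_exact_biprod (X Y : A) : split_exact (bin1 X Y) (bpr2 X Y).
Proof. by exists (bpr1 X Y), (bin2 X Y); rewrite !bpE bsum. Qed.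

Section BiprodMap.
Variables (X Y X' Y' : complex A) (f : chain_map X X') (g : chain_map Y Y').

Lemma chain_biprod_map_cmd n : cd (chain_biprod X' Y') n ∘ tri (f n) 0 (g n) =
  tri (f (n - 1)) 0 (g (n - 1)) ∘ cd (chain_biprod X Y) n.
Proof. by rewrite /= !tri_comp !cmd !compm0 !comp0m. Qed.

Definition chain_biprod_map : chain_map (chain_biprod X Y) (chain_biprod X' Y') :=
  @ChainMap A (chain_biprod X Y) (chain_biprod X' Y') (fun n => tri (f n) 0 (g n))
    chain_biprod_map_cmd.

End BiprodMap.

Section Copair.
Variables (X Y Z : complex A) (f : chain_map X Z) (g : chain_map Y Z).

Lemma chain_copair_cmd n : cd Z n ∘ (f n ∘ bpr1 _ _ + g n ∘ bpr2 _ _) =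
  (f (n - 1) ∘ bpr1 _ _ + g (n - 1) ∘ bpr2 _ _) ∘ cd (chain_biprod X Y) n.
Proof. by rewrite /= !bpE !cmd add0r. Qed.

Definition chain_copair : chain_map (chain_biprod X Y) Z :=
  @ChainMap A (chain_biprod X Y) Z (fun n => f n ∘ bpr1 _ _ + g n ∘ bpr2 _ _)
    chain_copair_cmd.

End Copair.
End PathComplex.

Section Rectification.
Variable A : add_category.

Section Tower.
Variables (Y : nat -> complex A) (t : forall n, chain_map (Y n.+1) (Y n)).

(** The path complex of the previous stage maps onto that stage with a degreewise section, which
    makes the transition map split. It is added as a direct summand of complexes, so that the
    cokernel of [rect_in] is split acyclic. *)
Fixpoint rect n : complex A :=
  if n is m.+1 then chain_biprod (Y m.+1) (path_complex (rect m)) else Y 0.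

Definition rect_in n : chain_map (Y n) (rect n) :=
  match n return chain_map (Y n) (rect n) with
  | 0 => ch_id (Y 0)
  | m.+1 => chain_bin1 (Y m.+1) (path_complex (rect m))
  end.

Definition rect_trans n : chain_map (rect n.+1) (rect n) :=
  chain_copair (ch_comp (rect_in n) (t n)) (path_out (rect n)).

Lemma rect_in_natural n k : rect_trans n k ∘ rect_in n.+1 k = rect_in n k ∘ t n k.
Proof. by rewrite /= !bpE addr0. Qed.

Lemma rect_trans_split n k :
  rect_trans n k ∘ (bin2 (Y n.+1 k) (path_complex (rect n) k) ∘ bin1 _ _) = idm _.
Proof. by rewrite /= !bpE add0r. Qed.

(** The path complex has [X n] and [X (n + 1)] in degree [n], so it does not raise the upper
    bound. *)
Lemma rect_concentrated :
  (forall n : nat, concentrated_le n (Y n)) ->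
    forall n : nat, concentrated_le n (rect n).
Proof.
move=> cY; elim=> [|n IHn] k lt_n_k; first exact: cY.
have lt_n : (n%:Z < k) by apply: lt_trans lt_n_k; rewrite ltz_nat.
apply: biprod_zero; first exact: cY.
apply: biprod_zero; first exact: IHn.
by apply: IHn; apply: lt_trans lt_n _; rewrite ltrDl.
Qed.

End Tower.

Fixpoint rect_map (Y Y' : nat -> complex A) (f : forall n, chain_map (Y n) (Y' n)) n :
    chain_map (rect Y n) (rect Y' n) :=
  match n return chain_map (rect Y n) (rect Y' n) with
  | 0 => f 0
  | m.+1 => chain_biprod_map (f m.+1) (path_map (rect_map f m))
  end.

Lemma rect_map_id (Y : nat -> complex A) (f : forall n, chain_map (Y n) (Y n)) :
  (forall n k, f n k = idm (Y n k)) -> forall n k, rect_map f n k = idm (rect Y n k).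
Proof.
move=> f1; elim=> [|n IHn] k; first exact: f1.
by rewrite /= f1 !IHn !tri_id.
Qed.

Lemma rect_map_comp (Y Y' Y'' : nat -> complex A) (f : forall n, chain_map (Y n) (Y' n))
    (g : forall n, chain_map (Y' n) (Y'' n)) (h : forall n, chain_map (Y n) (Y'' n)) :
  (forall n k, h n k = g n k ∘ f n k) ->
  forall n k, rect_map h n k = rect_map g n k ∘ rect_map f n k.
Proof.
move=> hE; elim=> [|n IHn] k; first exact: hE.
by rewrite /= !tri_comp hE !IHn !bpE !addr0.
Qed.

Section Naturality.
Variables (Y Y' : nat -> complex A) (t : forall n, chain_map (Y n.+1) (Y n))
  (t' : forall n, chain_map (Y' n.+1) (Y' n)) (f : forall n, chain_map (Y n) (Y' n)).

Lemma rect_map_in n k : rect_map f n k ∘ rect_in Y n k = rect_in Y' n k ∘ f n k.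
Proof.
case: n => [|n] /=; first by rewrite comp1m compm1.
by apply: pair_ext; rewrite !bpE ?addr0.
Qed.

Lemma rect_map_trans : is_tower_chain_map t t' f ->
  is_tower_chain_map (rect_trans t) (rect_trans t') (rect_map f).
Proof.
move=> ft n k; have E := rect_map_in n k; move: E.
rewrite /= !bpE add0r => ->.
by rewrite -(compA _ (t' n k)) ft compA.
Qed.

End Naturality.
End Rectification.

Section RectificationExact.
Variable E : exact_category.
Hypothesis wic : weakly_idempotent_complete E.

Lemma weak_equiv_rect_in (Y : nat -> complex E) n : weak_equiv (rect_in Y n).
Proof.
case: n => [|n]; first exact: weak_equiv_id.
apply: (weak_equiv_acyclic_cokernel wic (g := chain_bpr2 _ _)).
  by move=> k; apply: split_exact_ses; apply: split_exact_biprod.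
exact/split_acyclic_acyclic/path_split_acyclic.
Qed.

End RectificationExact.

Section AdditiveFunctor.
Variables (D E : exact_category) (F : add_functor D E).

Lemma add_funB (X Y : D) (f g : Hom X Y) :
  fmap F (f - g : Hom X Y) = (fmap F f : Hom (F X) (F Y)) - fmap F g.
Proof.
by apply: (@addIr _ (fmap F g : Hom (F X) (F Y))); rewrite -add_funD !subrK.
Qed.

Lemma add_fun_split_exact (X Y Z : D) (f : Hom X Y) (g : Hom Y Z) :
  split_exact f g -> @split_exact E (F X) (F Y) (F Z) (fmap F f) (fmap F g).
Proof.
move=> [r [s [rf gs gf rs fr]]]; exists (fmap F r), (fmap F s).
split; rewrite -!fmap_comp.
- by rewrite rf fmap_id.
- by rewrite gs fmap_id.
- by rewrite gf add_fun0.
- by rewrite rs add_fun0.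
- by rewrite -add_funD fr fmap_id.
Qed.

Lemma Ch_functor_split_acyclic (X : complex D) :
  split_acyclic X -> split_acyclic (Ch_functor F X).
Proof.
move=> [Z [i [p H]]].
exists (fun n => F (Z n)), (fun n => fmap F (i n)), (fun n => fmap F (p n)) => n.
have [s dip] := H n; split; first exact: add_fun_split_exact.
by rewrite /= dip fmap_comp.
Qed.

Hypothesis wic : weakly_idempotent_complete E.

(** [F] may destroy weak equivalences, but it keeps the degreewise splitting and the split acyclic
    cokernel of [rect_in]. *)
Lemma weak_equiv_fun_rect_in (Y : nat -> complex D) n :
  weak_equiv (Ch_hom F (rect_in Y n)).
Proof.
case: n => [|n].
  by apply: weak_equiv_iso => k; exists (idm _); rewrite /= fmap_id comp1m.
apply: (weak_equiv_acyclic_cokernel wic (g := Ch_hom F (chain_bpr2 _ _))).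
  move=> k; apply: split_exact_ses; apply: add_fun_split_exact.
  exact: split_exact_biprod.
apply: split_acyclic_acyclic; apply: Ch_functor_split_acyclic.
exact: path_split_acyclic.
Qed.

Lemma weak_equiv_fun_iso (X Y : complex D) (f : chain_map X Y) :
  (forall n, is_iso (f n)) -> weak_equiv (Ch_hom F f).
Proof.
move=> fi; apply: weak_equiv_iso => n; have [g [gf fg]] := fi n.
by exists (fmap F g); rewrite /= -!fmap_comp gf fg !fmap_id.
Qed.

Hypothesis wicD : weakly_idempotent_complete D.
Hypothesis coelD : weakly_omega_coelementary D.

Section SplitTower.
Variables (Y : nat -> complex D) (t : forall n, chain_map (Y n.+1) (Y n)).
Hypothesis ts : forall n k, exists s, t n k ∘ s = idm (Y n k).

Let split_one_minus (P : product_complex Y) k :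
  exists sigma, one_minus_shift t P k ∘ sigma = idm (P k).
Proof.
have /dep_choice [s st] n := ts n k.
by apply: (one_minus_split (@pprP _ _ P k)) st => n; apply: ppr_one_minus_shift.
Qed.

Let one_minus_kernel (P : product_complex Y) k :
  exists (K : D) (i : Hom K (P k)), is_kernel i (one_minus_shift t P k).
Proof. by have [sigma us] := split_one_minus P k; apply: wicD us. Qed.

(** Here [1 - t] has a section in each degree, so weak idempotent completeness provides its
    kernel. *)
Lemma split_tower_limit_exists : exists (L : complex D) (l : forall n,
  chain_map L (Y n)),
  is_tower_limit (C := Ch D) (X := @Tower (Ch D) Y t) l.
Proof.
have [P] := product_complex_exists coelD Y.
have [K [i ker]] := kernel_complex (one_minus_kernel P).
by exists K; eexists; apply: kernel_is_limit ker.
Qed.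

Lemma fun_split_tower_hlim (L : complex D) (l : forall n, chain_map L (Y n)) :
  preserves_countable_products F ->
  is_tower_limit (C := Ch D) (X := @Tower (Ch D) Y t) l ->
  is_hlim (fun n => Ch_hom F (t n)) (fun n => Ch_hom F (l n)).
Proof.
move=> Fprod lim; have [P] := product_complex_exists coelD Y.
have [cl ker] := limit_is_kernel (@one_minus_kernel P) lim.
have FP k : is_product (fun n => Ch_hom F (ppr P n) k).
  exact: (Fprod nat _ _ _ (@pprP _ _ P k)).
have cFl : is_chain_cone (fun n => Ch_hom F (t n)) (fun n => Ch_hom F (l n)).
  by move=> n k; rewrite /= -fmap_comp cl.
apply: (hlim_of_ses wic (P := @ProductComplex E (fun n => Ch_ob F (Y n)) (Ch_ob F P)
  (fun n => Ch_hom F (ppr P n)) FP) cFl) => k.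
apply: split_exact_ses.
set P' := ProductComplex _.
have -> : tuple_map P' (fun n => Ch_hom F (l n)) k = fmap F (tuple_map P l k).
  apply: (product_ext (@pprP _ _ P' k)) => n.
  by rewrite ppr_tuple_map /= -fmap_comp ppr_tuple_map.
have -> : one_minus_shift (fun n => Ch_hom F (t n)) P' k = fmap F (one_minus_shift t P
  k).
  apply: (product_ext (@pprP _ _ P' k)) => n.
  rewrite ppr_one_minus_shift /= -!fmap_comp ppr_one_minus_shift.
  by rewrite add_funB.
apply: add_fun_split_exact; have [sigma us] := split_one_minus P k.
exact: kernel_split_exact us.
Qed.

End SplitTower.
End AdditiveFunctor.

(** * The deformation *)

Lemma ch_compE (A : add_category) (X Y Z : complex A) (g : chain_map Y Z)
  (f : chain_map X Y) k : ch_comp g f k = g k ∘ f k.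
Proof. by []. Qed.

Lemma Ch_homE (D E : add_category) (F : add_functor D E) (X Y : complex D)
  (f : chain_map X Y) k : Ch_hom F f k = fmap F (f k).
Proof. by []. Qed.

Section Deformation.
Variables (D E : exact_category) (F : add_functor D E).
Hypothesis wicD : weakly_idempotent_complete D.
Hypothesis wicE : weakly_idempotent_complete E.
Hypothesis coelD : weakly_omega_coelementary D.
Hypothesis coelE : weakly_omega_coelementary E.
Hypothesis Fprod : preserves_countable_products F.

(* [G n] plays the role of [Q_- T_n], and [eps n] of [X -> T_n X -> Q_- T_n X]. *)
Variable P : complex D -> Prop.
Variable G : nat -> complex D -> complex D.
Variable Gm : forall n (X Y : complex D), chain_map X Y -> chain_map (G n X) (G n Y).
Variable Gt : forall n X, chain_map (G n.+1 X) (G n X).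
Variable eps : forall n X, chain_map X (G n X).
Hypothesis Gm_id : forall n X k, Gm n (ch_id X) k = idm _.
Hypothesis Gm_comp : forall n X Y Z (g : chain_map Y Z) (f : chain_map X Y) k,
  Gm n (ch_comp g f) k = Gm n g k ∘ Gm n f k.
Hypothesis Gt_natural : forall n X Y (f : chain_map X Y) k,
  Gt n Y k ∘ Gm n.+1 f k = Gm n f k ∘ Gt n X k.
Hypothesis eps_natural : forall n X Y (f : chain_map X Y) k,
  Gm n f k ∘ eps n X k = eps n Y k ∘ f k.
Hypothesis Gt_eps : forall n X k, Gt n X k ∘ eps n.+1 X k = eps n X k.
Hypothesis Gm_weak_equiv : forall n X Y (f : chain_map X Y),
  weak_equiv f -> weak_equiv (Gm n f).
Hypothesis eps_weak_equiv : forall (n : nat) X, concentrated_le n X ->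
  weak_equiv (eps n X).
Hypothesis Gm_eps_weak_equiv : forall n X, weak_equiv (Gm n (eps n.+1 X)).
Hypothesis G_concentrated : forall (n : nat) X, concentrated_le n (G n X).
Hypothesis GP : forall n X, P (G n X).
Hypothesis FP : preserves_weak_equiv_on P (Ch_functor F).
Hypothesis eps_hlim : forall X, is_hlim (fun n => Gt n X) (fun n => eps n X).

Local Notation R X := (rect (fun n => G n X)).
Local Notation Rt X := (rect_trans (fun n => Gt n X)).
Local Notation Rin X := (rect_in (fun n => G n X)).
Local Notation Rm f := (rect_map (fun n => Gm n f)).

Let Rt_split X n k : exists s, Rt X n k ∘ s = idm (R X n k).
Proof. by eexists; apply: (rect_trans_split (fun n => Gt n X)). Qed.

Lemma deformation_limits : exists (L : complex D -> complex D)
  (l : forall X n, chain_map (L X) (R X n)),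
  forall X, is_tower_limit (C := Ch D) (X := @Tower (Ch D) (R X) (Rt X)) (l X).
Proof.
have /dep_choice [L /dep_choice [l lim]] : forall X, exists (L : complex D)
    (l : forall n, chain_map L (R X n)),
    is_tower_limit (C := Ch D) (X := @Tower (Ch D) (R X) (Rt X)) l.
  by move=> X; apply: (split_tower_limit_exists wicD coelD (Rt_split X)).
by exists L, l.
Qed.

Section Limits.
Variables (L : complex D -> complex D) (l : forall X n, chain_map (L X) (R X n)).
Hypothesis lim :
  forall X, is_tower_limit (C := Ch D) (X := @Tower (Ch D) (R X) (Rt X)) (l X).

Let l_cone X n k : Rt X n k ∘ l X n.+1 k = l X n k.
Proof. by have /(congr1 (fun z : chain_map _ _ => z k)) := (lim X).1 n. Qed.

Lemma deformation_map X Y (f : chain_map X Y) :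
  {g : chain_map (L X) (L Y) | forall n k, l Y n k ∘ g k = Rm f n k ∘ l X n k}.
Proof.
apply: cid; apply: (chain_limit_lift (w := fun n => ch_comp (Rm f n) (l X n)) (lim Y)).
move=> n k; rewrite /= compA.
have -> : Rt Y n k ∘ Rm f n.+1 k = Rm f n k ∘ Rt X n k.
  by apply: (rect_map_trans (t := fun n => Gt n X)) => j i; apply: Gt_natural.
by rewrite -compA l_cone.
Qed.

Definition Lm X Y (f : chain_map X Y) : chain_map (L X) (L Y) :=
  sval (deformation_map f).

Lemma LmE X Y (f : chain_map X Y) n k : l Y n k ∘ Lm f k = Rm f n k ∘ l X n k.
Proof. exact: (svalP (deformation_map f)). Qed.

Lemma Lm_id (X : complex D) : Lm (ch_id X) = ch_id (L X).
Proof.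
apply: (chain_limit_ext (lim X)) => n k; rewrite LmE rect_map_id.
  by rewrite comp1m compm1.
by move=> *; apply: Gm_id.
Qed.

Lemma Lm_comp X Y Z (g : chain_map Y Z) (f : chain_map X Y) :
  Lm (ch_comp g f) = ch_comp (Lm g) (Lm f).
Proof.
apply: (chain_limit_ext (lim Z)) => n k; rewrite LmE /= compA LmE -compA LmE compA.
congr (_ ∘ _); apply: rect_map_comp => j i; exact: Gm_comp.
Qed.

Definition deformation : functor (Ch D) (Ch D) :=
  @Functor (Ch D) (Ch D) L Lm Lm_id Lm_comp.

Lemma deformation_unit X :
  {g : chain_map X (L X) | forall n k, l X n k ∘ g k = Rin X n k ∘ eps n X k}.
Proof.
apply: cid; apply: (chain_limit_lift (w := fun n => ch_comp (Rin X n) (eps n X)) (lim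
  X)).
move=> n k; rewrite /= compA (rect_in_natural (fun n => Gt n X)).
by rewrite -compA Gt_eps.
Qed.

Definition Lu X : chain_map X (L X) := sval (deformation_unit X).

Lemma LuE X n k : l X n k ∘ Lu X k = Rin X n k ∘ eps n X k.
Proof. exact: (svalP (deformation_unit X)). Qed.

Lemma Lu_natural X Y (f : chain_map X Y) : ch_comp (Lm f) (Lu X) = ch_comp (Lu Y) f.
Proof.
apply: (chain_limit_ext (lim Y)) => n k; rewrite /= !compA LmE LuE -!compA LuE.
by rewrite compA rect_map_in -!compA eps_natural.
Qed.

Lemma Lu_weak_equiv X : weak_equiv (Lu X).
Proof.
apply: (hlim_compare wicD (f := Rin X) _ _ (eps_hlim X)
  (hlim_of_limit wicD coelD _ (lim X))).
- apply: (hlim_equiv_levelwise wicD coelD) => [n k|n]; last exact: weak_equiv_rect_in.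
  exact: rect_in_natural.
- by move=> n k; rewrite LuE.
- move=> k; exists 0%N => n _; have [s ts] := Rt_split X n k.
  exact: adm_epi_split ts.
Qed.

Lemma R_concentrated X (n : nat) : concentrated_le n (R X n).
Proof. by apply: rect_concentrated => j; apply: G_concentrated. Qed.

(** A condition on [X] alone, in terms of constructions natural in all chain maps: [F] preserves
    weak equivalences between complexes that satisfy it. *)
Definition computed_by_tower X : Prop :=
  is_hlim (fun n => Ch_hom F (Gt n X)) (fun n => Ch_hom F (eps n X)).

Lemma fun_Gm_weak_equiv n X Y (f : chain_map X Y) :
  weak_equiv (Gm n f) -> weak_equiv (Ch_hom F (Gm n f)).
Proof. exact: FP. Qed.

Lemma fun_Gm_tower X Y (f : chain_map X Y) :
  is_tower_chain_map (fun n => Ch_hom F (Gt n X)) (fun n => Ch_hom F (Gt n Y))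
    (fun n => Ch_hom F (Gm n f)).
Proof. by move=> n k; rewrite /= -!fmap_comp Gt_natural. Qed.

(** [FP] does not apply to [eps n (R X n)], as [R X n] need not satisfy [P]. It does apply after
    precomposition with [G n X -> R X n], which [F] sends to a weak equivalence. *)
Lemma fun_eps_R_weak_equiv X n : weak_equiv (Ch_hom F (eps n (R X n))).
Proof.
apply: (weak_equiv_cancel_source wicE (f := Ch_hom F (Rin X n))
  (h := Ch_hom F (ch_comp (eps n (R X n)) (Rin X n)))).
- by move=> k; rewrite /= -fmap_comp.
- exact: weak_equiv_fun_rect_in.
- apply: FP => //.
  apply: (weak_equiv_comp wicD (f := Rin X n) (g := eps n (R X n))) => //.
    exact: weak_equiv_rect_in.
  by apply: eps_weak_equiv; apply: R_concentrated.
Qed.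

(** By [LuE], [l ∘ Lu = Rin ∘ eps]; every map in this square other than [l] becomes a weak
    equivalence under [G n], for [eps] by the hypothesis on stage [n.+1]. *)
Lemma Gm_l_weak_equiv X n : weak_equiv (Gm n (l X n.+1)).
Proof.
apply: (weak_equiv_cancel_source wicD (f := Gm n (Lu X))
  (h := ch_comp (Gm n (Rin X n.+1)) (Gm n (eps n.+1 X)))).
- move=> k; rewrite /= -!Gm_comp; congr (cm (Gm n _) k).
  by apply: chain_map_eq => j; exact: (LuE X n.+1 j).
- exact/Gm_weak_equiv/Lu_weak_equiv.
- apply: (weak_equiv_comp wicD _ (Gm_eps_weak_equiv n X)) => //.
  by apply: Gm_weak_equiv; apply: weak_equiv_rect_in.
Qed.

(* The tower [G_n R_n] is reached from [G_n L] through [G_n R_(n+1)], because only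
   [X -> T_(n+1) X] is known to become a weak equivalence under [T_n]. *)
Lemma computed_by_tower_L X : computed_by_tower (L X).
Proof.
have h1 : is_hlim (fun n => Ch_hom F (Rt X n)) (fun n => Ch_hom F (l X n)).
  exact: (fun_split_tower_hlim wicE wicD coelD (Rt_split X) Fprod (lim X)).
pose t2 n := Ch_hom F (ch_comp (Gt n (R X n)) (Gm n.+1 (Rt X n))).
pose l2 n := Ch_hom F (ch_comp (eps n (R X n)) (l X n)).
have h2 : is_hlim t2 l2.
  apply: (hlim_target wicE coelE (f := fun n => Ch_hom F (eps n (R X n)))
    (g := ch_id (Ch_ob F (L X))) _ _ _ h1 (weak_equiv_id _)).
  - apply: (hlim_equiv_levelwise wicE coelE) => [n k|n].
      by rewrite /t2 /l2 !Ch_homE !ch_compE -!fmap_comp -compA eps_natural compA Gt_eps.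
    exact: fun_eps_R_weak_equiv.
  - by move=> n k; rewrite /t2 /l2 !Ch_homE !ch_compE -fmap_comp compm1.
  - move=> n k; rewrite /t2 /l2 !Ch_homE !ch_compE -!fmap_comp -!compA (compA (Gm _ _
      _)) eps_natural.
    by rewrite !compA Gt_eps -compA l_cone.
pose t1 n := Ch_hom F (ch_comp (Gt n (R X n.+1)) (Gm n.+1 (Rt X n.+1))).
pose l1 n := Ch_hom F (ch_comp (eps n (R X n.+1)) (l X n.+1)).
have h3 : is_hlim t1 l1.
  apply: (hlim_source wicE coelE (f := fun n => Ch_hom F (Gm n (Rt X n)))
    (g := ch_id (Ch_ob F (L X))) _ _ _ h2 (weak_equiv_id _)).
  (* [G_n R_(n+1)] sits between [G_(n+1) R_(n+1)] and [G_n R_n]: the first maps to it by [Gt], and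
     it maps to the second by [Gm n (Rt X n)]. The composites are the transition maps of the two
     towers. *)
  - apply: (hlim_equiv_interleaved wicE (sigma := fun n => Ch_hom F (Gt n (R X n.+1)))).
    + by move=> n k; rewrite /t1 /l1 /t2 /l2 !Ch_homE !ch_compE -!fmap_comp Gt_natural
        compA.
    + by move=> n k; rewrite /t1 /l1 /t2 /l2 !Ch_homE !ch_compE -fmap_comp Gt_natural.
    + by move=> n k; rewrite /t1 /l1 /t2 /l2 !Ch_homE !ch_compE -fmap_comp.
  - by move=> n k; rewrite /t1 /l1 /t2 /l2 !Ch_homE !ch_compE -fmap_comp compm1 compA
      eps_natural -compA l_cone.
  - move=> n k; rewrite /t1 /l1 /t2 /l2 !Ch_homE !ch_compE -!fmap_comp -!compA (compA
      (Gm _ _ _)) eps_natural.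
    by rewrite !compA Gt_eps -compA l_cone.
apply: (hlim_source wicE coelE (f := fun n => Ch_hom F (Gm n (l X n.+1)))
  (g := ch_id (Ch_ob F (L X))) _ _ _ h3 (weak_equiv_id _)).
- apply: (hlim_equiv_levelwise wicE coelE) => [n k|n].
    rewrite /t1 /l1 !Ch_homE !ch_compE -!fmap_comp -compA -Gm_comp -Gt_natural;
      congr (fmap F (_ ∘ cm (Gm _ _) k)).
    by apply: chain_map_eq => j; apply: l_cone.
  exact/fun_Gm_weak_equiv/Gm_l_weak_equiv.
- by move=> n k; rewrite /t1 /l1 !Ch_homE !ch_compE -fmap_comp compm1 eps_natural.
- by move=> n k; rewrite /t1 /l1 !Ch_homE -fmap_comp Gt_eps.
Qed.

(** Needed because the essential image also contains the complexes merely isomorphic to some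
    [L X]. *)
Lemma computed_by_tower_iso X Y (f : chain_map X Y) :
  (forall k, is_iso (f k)) -> computed_by_tower X -> computed_by_tower Y.
Proof.
move=> fi hX; apply: (hlim_target wicE coelE (f := fun n => Ch_hom F (Gm n f))
    (g := Ch_hom F f) _ _ _ hX (weak_equiv_fun_iso F fi)).
- apply: (hlim_equiv_levelwise wicE coelE (fun_Gm_tower f)) => n.
  exact/fun_Gm_weak_equiv/Gm_weak_equiv/weak_equiv_iso.
- by move=> n k; rewrite !Ch_homE -!fmap_comp eps_natural.
- by move=> n k; rewrite !Ch_homE -fmap_comp Gt_eps.
Qed.

Lemma deformation_right_deformable : right_deformable (Ch_functor F).
Proof.
exists deformation, (@NatTrans (Ch D) (Ch D) (id_functor (Ch D)) deformation Lu
  Lu_natural).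
split; first exact: Lu_weak_equiv.
have computed A : ess_image deformation A -> computed_by_tower A.
  move=> [X [f [g [gf fg]]]].
  apply: (computed_by_tower_iso (f := f)) (computed_by_tower_L X) => k.
  exists (cm g k); split.
    by have /(congr1 (fun z : chain_map _ _ => z k)) := gf.
  by have /(congr1 (fun z : chain_map _ _ => z k)) := fg.
move=> A A' f /computed hA /computed hA' wf.
apply: (hlim_compare wicE (f := fun n => Ch_hom F (Gm n f)) _ _ hA hA').
  apply: (hlim_equiv_levelwise wicE coelE (fun_Gm_tower f)) => n.
  exact/fun_Gm_weak_equiv/Gm_weak_equiv.
by move=> n k; rewrite /= -!fmap_comp eps_natural.
Qed.

End Limits.

Lemma right_deformable_of_towers : right_deformable (Ch_functor F).
Proof. by have [L [l lim]] := deformation_limits;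
  apply: deformation_right_deformable lim. Qed.

End Deformation.

(** * The truncation tower and the proof of the theorem *)

Section BoundedDeformation.
Variables (D : exact_category) (T : right_truncation_system D).
Hypothesis wic : weakly_idempotent_complete D.

Lemma trunc_natural_unit n (X Y : complex D) (f : chain_map X Y) k :
  cm (@fmap _ _ (T n) X Y f) k ∘ cm (trunc_unit T n X) k =
  cm (trunc_unit T n Y) k ∘ f k.
Proof.
exact: (congr1 (fun z : chain_map _ _ => z k) (@ntc_nat _ _ _ _ (trunc_unit T n) X Y
  f)).
Qed.

Lemma trunc_unit_compat_at n (X : complex D) k :
  cm (trunc_map T n X) k ∘ cm (trunc_unit T n.+1 X) k = cm (trunc_unit T n X) k.
Proof.
exact: (congr1 (fun z : chain_map _ _ => z k) (trunc_unit_compat T n X)).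
Qed.

Lemma trunc_bounded n (X : complex D) : bounded_above (T n X).
Proof. by exists n; apply: trunc_conc. Qed.

Definition bounded_trunc n (X : complex D) : Ch_minus D :=
  exist _ (T n X : complex D) (trunc_bounded n X).

Lemma trunc_hlim (coel : weakly_omega_coelementary D) (X : complex D) :
  admissible_truncation T -> homologically_left_complete T ->
  is_hlim (Y := fun n => T n X) (fun n => trunc_map T n X) (fun n => trunc_unit T n X).
Proof.
move=> adm [L [pi [psi [lim pipsi wpsi]]]].
have hL : is_hlim (Y := fun n => T n X) (fun n => trunc_map T n X) (fun n => pi n X).
  apply: (hlim_of_limit wic coel _ (lim X)) => k.
  (* Admissibility covers degree [k] as soon as [k < n]; the absolute value supplies a natural
     number for every integer [k]. *)
  exists `|k|.+1 => n lt_k_n; apply: adm.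
  by apply: le_lt_trans (lez_abs k) _; rewrite ltz_nat.
apply: (hlim_source wic coel (Y := fun n => T n X) (Y' := fun n => T n X)
  (f := fun n => ch_id (T n X)) (g := psi X) _ _ _ hL (wpsi X)).
- apply: (hlim_equiv_levelwise wic coel) => [n k|n]; last exact: weak_equiv_id.
  by rewrite /= compm1 comp1m.
- move=> n k; rewrite /= comp1m.
  exact/esym/(congr1 (fun z : chain_map _ _ => z k) (pipsi X n)).
- by move=> n k; apply: trunc_unit_compat_at.
Qed.

End BoundedDeformation.

Theorem theorem3p24 (D E : exact_category) (F : add_functor D E)
    (T : right_truncation_system D) (B : Ch_minus D -> Prop) :
  weakly_idempotent_complete D ->
  weakly_idempotent_complete E ->
  weakly_omega_coelementary D ->
  weakly_omega_coelementary E ->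
  admissible_truncation T ->
  homologically_left_complete T ->
  preserves_countable_products F ->
  homological_right_deformation_of B F ->
  right_deformable (Ch_functor F).
Proof.
move=> wicD wicE coelD coelE adm complete Fprod [[_ [Q [eta [wq _ concq]]]] FB].
pose TB n X := bounded_trunc T n X.
pose G n (X : complex D) : complex D := sval (sval (Q (TB n X))).
pose eta_at n X : chain_map (T n X) (G n X) := eta (TB n X).
pose Qmap (X Y : Ch_minus D) (f : chain_map (sval X) (sval Y)) :
  chain_map (sval (sval (Q X))) (sval (sval (Q Y))) := @fmap _ _ Q X Y f.
have eta_natural X Y (f : chain_map (sval X) (sval Y)) k :
    Qmap X Y f k ∘ cm (eta X) k = cm (eta Y) k ∘ f k.
  exact: (congr1 (fun z : chain_map _ _ => z k) (@ntc_nat _ _ _ _ eta X Y f)).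
have Qmap_id X : Qmap X X (ch_id (sval X)) = ch_id _ by exact: (fmap_id Q X).
have Qmap_comp X Y Z (g : chain_map (sval Y) (sval Z)) (f : chain_map (sval X) (sval
  Y)) :
    Qmap X Z (ch_comp g f) = ch_comp (Qmap Y Z g) (Qmap X Y f).
  exact: (@fmap_comp _ _ Q X Y Z g f).
(* Naturality of [eta] and two-out-of-three make [Q_-] preserve weak equivalences. *)
have Qmap_we X Y (f : chain_map (sval X) (sval Y)) : weak_equiv f ->
  weak_equiv (Qmap X Y f).
  move=> wf; apply: (weak_equiv_cancel_source wicD (f := eta X)
    (h := ch_comp (eta Y) f)) => //.
    by move=> k; apply: eta_natural.
  by apply: (weak_equiv_comp wicD _ wf (wq Y)).
pose Gm n X Y (f : chain_map X Y) : chain_map (G n X) (G n Y) :=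
  Qmap (TB n X) (TB n Y) (@fmap _ _ (T n) X Y f).
pose Gt n X : chain_map (G n.+1 X) (G n X) :=
  Qmap (TB n.+1 X) (TB n X) (trunc_map T n X).
pose eps n X : chain_map X (G n X) := ch_comp (eta_at n X) (trunc_unit T n X).
have GmC n X Y Z (g : chain_map Y Z) (f : chain_map X Y) :
    Gm n _ _ (ch_comp g f) = ch_comp (Gm n _ _ g) (Gm n _ _ f).
  rewrite /Gm -Qmap_comp; congr (Qmap _ _ _).
  exact: (@fmap_comp _ _ (T n) X Y Z g f).
have Gm_we n X Y (f : chain_map X Y) : weak_equiv f -> weak_equiv (Gm n _ _ f).
  by move=> wf; apply: Qmap_we; apply: trunc_preserves.
apply: (@right_deformable_of_towers D E F wicD wicE coelD coelE Fprod
  (fun X => exists Xb : bounded_above X, B (exist _ X Xb)) G Gm Gt eps) => //.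
- move=> n X k; rewrite /Gm.
  have -> : @fmap _ _ (T n) X X (ch_id X) = ch_id (T n X : complex D).
    exact: (fmap_id (T n) X).
  by rewrite (Qmap_id (TB n X)).
- by move=> n X Y Z g f k; rewrite GmC.
- move=> n X Y f k; rewrite /Gt /Gm -!ch_compE -!Qmap_comp; congr (cm (Qmap _ _ _) k).
  exact/esym/(@ntc_nat _ _ _ _ (trunc_map T n) X Y f).
- move=> n X Y f k; rewrite /eps !ch_compE compA (eta_natural (TB n X) (TB n Y)).
  by rewrite -!compA trunc_natural_unit.
- move=> n X k; rewrite /eps !ch_compE compA (eta_natural (TB n.+1 X) (TB n X)).
  by rewrite -compA trunc_unit_compat_at.
- move=> n X cX; apply: (weak_equiv_comp wicD _ (trunc_unit_weak_equiv T cX) (wq (TB n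
    X))).
  by [].
(* The map is [Q_- T_n] of the truncation unit at stage [n.+1], handled by [trunc_trunc], followed
   by [Q_- T_n] of [eta]. *)
- move=> n X; rewrite /eps GmC.
  apply: (weak_equiv_comp wicD (f := Gm n _ _ (trunc_unit T n.+1 X))
    (g := Gm n _ _ (eta_at n.+1 X))) => //.
    exact/Qmap_we/trunc_trunc.
  exact/Gm_we/(wq (TB n.+1 X)).
- by move=> n X; apply: concq; apply: trunc_conc.
- by move=> n X; rewrite /G; case: (Q _) => -[Y Yb] BY; exists Yb.
(* [X] is the homotopy limit of its truncations, and [eta] replaces [T_n X] by [G n X] level by
   level. *)
- move=> X; apply: (hlim_target wicD coelD (Y := fun n => T n X)
    (f := fun n => eta_at n X) (g := ch_id X) _ _ _
    (trunc_hlim wicD coelD X adm complete) (weak_equiv_id X)).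
  + apply: (hlim_equiv_levelwise wicD coelD) => [n k|n]; last exact: (wq (TB n X)).
    exact: (eta_natural (TB n.+1 X) (TB n X)).
  + by move=> n k; rewrite compm1.
  + move=> n k; rewrite /eps !ch_compE compA (eta_natural (TB n.+1 X) (TB n X)).
    by rewrite -compA trunc_unit_compat_at.
Qed.
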